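(* Let $\star\in\{\mathrm{bond},\mathrm{site}\}$, and put $(\alpha,\kappa)=(1,1)$, $d_\star=1$ if $\star=\mathrm{bond}$ and $(\alpha,\kappa)=(2,4)$, $d_\star=p$ if $\star=\mathrm{site}$. Let $b_0=\beta_{\mathrm{BKT}}$ and $H_\kappa(t)=1-e^{-2\kappa t}$. Assume $p\in(0,1]$ and $\beta\ge0$ satisfy $$p^\alpha H_\kappa(\beta)\ge H_\kappa(b_0).$$ (1) For the free square $\Lambda_R=[-R,R]^2\cap\mathbb Z^2$, with integer $R\ge1$, $$\sum_{y\in\Lambda_R}\mathbb E\langle z_0\overline{z_y}\rangle_{\Lambda_R}\ge R+d_\star.$$ Writing $m=\lfloor R/2\rfloor$, $N=(2R+1)^2$ and $N_{\mathrm{core}}=(2m+1)^2$, we also have $$S_{\Lambda_R}(0)\ge d_\star+\frac{N_{\mathrm{core}}}{N}\,m.$$ (2) On an $L\times L$ square torus with integer $L\ge3$, put $R=\lfloor(L-1)/2\rfloor$. Then $$S_L(0)\ge R+d_\star,\qquad\mathbb E\langle|M_L|^2\rangle\ge\frac{R+d_\star}{L^2},\qquad\chi_{\mathrm{mag},L}\ge\frac\beta2(R+d_\star).$$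
   Context: XY model. Let $\mathbb T=\mathbb R/(2\pi\mathbb Z)$. For a finite graph $G=(V,E)$ and couplings $J_e\ge0$, the XY Gibbs measure is $$d\mu_{G,J}(\theta)=\frac1{Z_{G,J}}\exp\Bigl(\sum_{e=\{u,v\}\in E}J_e\cos(\theta_u-\theta_v)\Bigr)\prod_{v\in V}\frac{d\theta_v}{2\pi},\qquad\theta\in\mathbb T^V,$$ with expectation $\langle\cdot\rangle$. Free boundary conditions on $\Lambda_R$ mean that $G$ is the subgraph of nearest-neighbor $\mathbb Z^2$ induced on $\Lambda_R$; the $L\times L$ torus is $(\mathbb Z/L\mathbb Z)^2$ with its nearest-neighbor edges. Dilution. In the bond model, $J_e=\beta\omega_e$ with $(\omega_e)$ i.i.d. Bernoulli($p$). In the site model, $J_{\{u,v\}}=\beta\eta_u\eta_v$ with $(\eta_v)$ i.i.d. Bernoulli($p$); all vertices retain their angle variables, so vacant sites are isolated and carry independent uniform angles. $\mathbb E$ is the disorder expectation, taken after normalizing each Gibbs expectation. Spins. For bond dilution $z_x=e^{i\theta_x}$; for site dilution $z_x=\eta_xe^{i\theta_x}$. Structure factor and magnetization. For a finite volume $\Lambda$ (free square or torus), $$S_\Lambda(0)=\frac1{|\Lambda|}\mathbb E\Bigl\langle\Bigl|\sum_{x\in\Lambda}z_x\Bigr|^2\Bigr\rangle,\qquad M_\Lambda=\frac1{|\Lambda|}\sum_{x\in\Lambda}z_x.$$ $S_L$ and $M_L$ are these quantities on the $L\times L$ torus. Magnetic susceptibility. $\chi_{\mathrm{mag},L}$ is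 the zero-field response of one Cartesian magnetization component per original site to the energy term $-h\sum_x\operatorname{Re}z_x$: i.e. $\chi_{\mathrm{mag},L}=\frac{d}{dh}\big|_{h=0}\mathbb E\bigl\langle\frac1{L^2}\sum_x\operatorname{Re}z_x\bigr\rangle_h$, where $\langle\cdot\rangle_h$ is the Gibbs expectation on the torus with the extra factor $\exp(\beta h\sum_x\operatorname{Re}z_x)$ in the (renormalized) density. Clean critical point. $b_0=\beta_{\mathrm{BKT}}\in(0,\infty)$ is the critical inverse temperature of the clean XY model (all couplings equal to $\beta$) on $\mathbb Z^2$: the supremum of the $\beta\ge0$ for which the free infinite-volume two-point function $\langle\cos(\theta_0-\theta_x)\rangle_\beta$ decays exponentially in $|x|$. By the known exponential/algebraic dichotomy it equals the infimum of the $\beta\ge0$ for which this two-point function is at least $c(1+|x|)^{-s}$ for all $x\ne0$, for some $c>0$, $s\in[0,\infty)$. *)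

(* Defs.v *)
From HB Require Import structures.
From mathcomp Require Import all_boot all_order all_algebra.
From mathcomp Require Import all_classical all_reals all_analysis.
From mathcomp Require Import complex.
Set Implicit Arguments.
Unset Strict Implicit.
Unset Printing Implicit Defensive.
Import Order.TTheory GRing.Theory Num.Theory.
Import numFieldNormedType.Exports.
Local Open Scope classical_set_scope.
Local Open Scope ring_scope.

(* T^n is represented by n-tuples of angles, with reference measure the n-fold
   product of the uniform probability on [0, 2 pi].  All observables below are
   2 pi-periodic in each angle, so nothing depends on this choice of
   fundamental domain. *)
Section angle_measure.
Variable R : realType.

Lemma two_pi_gt0 : 0 < pi *+ 2 :> R.
Proof. by rewrite pmulrn_lgt0// pi_gt0. Qed.

Definition angle_prob : probability (measurableTypeR R) R :=
  uniform_prob two_pi_gt0.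

Definition cons_angle n
    (x : measurableTypeR R * n.-tuple (measurableTypeR R)) :
    n.+1.-tuple (measurableTypeR R) := [tuple of x.1 :: x.2].

Lemma measurable_cons_angle n :
  measurable_fun [set: measurableTypeR R * n.-tuple (measurableTypeR R)]
    (@cons_angle n).
Proof.
by apply: measurable_cons; [exact: measurable_fst | exact: measurable_snd].
Qed.

HB.instance Definition _ n :=
  isMeasurableFun.Build _ _ _ _ (@cons_angle n) (@measurable_cons_angle n).

Fixpoint angles_prob n : probability (n.-tuple (measurableTypeR R)) R :=
  match n with
  | 0 => \d_[tuple]
  | n'.+1 => distribution (angle_prob \x angles_prob n')%E (@cons_angle n')
  end.

End angle_measure.

Section gibbs.
Variables (R : realType) (V : finType).
Implicit Types (adj : rel V) (J : V -> V -> R).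

Definition angles := #|V|.-tuple (measurableTypeR R).

Definition angle (t : angles) (v : V) : R := tnth t (enum_rank v).

(* The sum runs over ordered pairs, hence the factor 1/2: for a symmetric
   irreflexive [adj] and a symmetric [J] each edge contributes once. *)
Definition xy_interaction adj J (t : angles) : R :=
  2^-1 * \sum_u \sum_(v | adj u v) J u v * cos (angle t u - angle t v).

(* Normalized expectation for the density proportional to exp W. *)
Definition gibbs (W f : angles -> R) : R :=
  Rintegral (@angles_prob R #|V|) setT (fun t => f t * expR (W t)) /
  Rintegral (@angles_prob R #|V|) setT (fun t => expR (W t)).

Definition clean_two_point adj (b : R) (u v : V) : R :=
  gibbs (xy_interaction adj (fun _ _ => b))
        (fun t => cos (angle t u - angle t v)).

End gibbs.

Variant dilution := Bond | Site.

Section diluted.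
Variables (R : realType) (star : dilution) (V : finType) (adj : rel V).
Variables (p beta : R).

Definition edges : {set {set V}} :=
  [set e : {set V} | [exists u, exists v, adj u v && (e == [set u; v])]]%SET.

(* Expectation over i.i.d. Bernoulli(p) variables indexed by A; S is the set of
   indices whose variable equals 1. *)
Definition bernoulli_expect (T : finType) (A : {set T}) (F : {set T} -> R) : R :=
  \sum_(S in powerset A) (\prod_(i in A) (if i \in S then p else 1 - p)) * F S.

Definition spin (eta : V -> R) (t : angles R V) (x : V) : R[i] :=
  (eta x * cos (angle t x) +i* (eta x * sin (angle t x)))%C.

(* < f(z) >_h for couplings J and occupation variables eta. *)
Definition gibbs_field (J : V -> V -> R) (eta : V -> R) (h : R)
    (f : (V -> R[i]) -> R) : R :=
  gibbs (fun t => xy_interaction adj J t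
                  + beta * h * \sum_x complex.Re (spin eta t x))
        (fun t => f (spin eta t)).

(* E < f(z) >_h *)
Definition quenched_field (h : R) (f : (V -> R[i]) -> R) : R :=
  match star with
  | Bond => bernoulli_expect edges (fun omega =>
      gibbs_field (fun u v => beta * ([set u; v]%SET \in omega)%:R) (fun=> 1) h f)
  | Site => bernoulli_expect [set: V]%SET (fun eta =>
      gibbs_field (fun u v => beta * (u \in eta)%:R * (v \in eta)%:R)
                  (fun x => (x \in eta)%:R) h f)
  end.

Definition quenched (f : (V -> R[i]) -> R) : R := quenched_field 0 f.

Definition quenchedC (f : (V -> R[i]) -> R[i]) : R[i] :=
  (quenched (fun z => complex.Re (f z)) +i*
   quenched (fun z => complex.Im (f z)))%C.

Definition sqr_modulus (w : R[i]) : R := complex.Re (`|w| ^+ 2).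

Definition structure_factor : R :=
  #|V|%:R^-1 * quenched (fun z => sqr_modulus (\sum_x z x)).

Definition magnetization (z : V -> R[i]) : R[i] := #|V|%:R^-1 * \sum_x z x.

Definition susceptibility : R :=
  derive1 (fun h : R => quenched_field h
    (fun z => #|V|%:R^-1 * \sum_x complex.Re (z x))) 0.

End diluted.

Section square_lattice.

(* The vertices of [-r, r]^2 are stored as pairs of offsets from the corner
   (-r, -r). *)
Definition box (r : nat) : Type := ('I_(r.*2.+1) * 'I_(r.*2.+1))%type.
HB.instance Definition _ r := Finite.on (box r).

Definition box_pos r (u : box r) : int * int :=
  (u.1%:Z - r%:Z, u.2%:Z - r%:Z).

(* The vertex at position x; it is meaningful only for x in [-r, r]^2. *)
Definition box_vertex r (x : int * int) : box r :=
  (inord (absz (x.1 + r%:Z)), inord (absz (x.2 + r%:Z))).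

Definition box_origin r : box r := box_vertex r (0, 0).

Definition box_adj r : rel (box r) := fun u v =>
  (`|(box_pos u).1 - (box_pos v).1| + `|(box_pos u).2 - (box_pos v).2| == 1).

Definition torus (L : nat) : Type := ('I_L * 'I_L)%type.
HB.instance Definition _ L := Finite.on (torus L).

Definition cycle_adj L : rel 'I_L := fun i j => (j == ordS i) || (i == ordS j).

(* For L >= 3 this is a simple graph. *)
Definition torus_adj L : rel (torus L) := fun u v =>
  (u.1 == v.1) && cycle_adj u.2 v.2 || (u.2 == v.2) && cycle_adj u.1 v.1.

End square_lattice.

Section critical_point.
Variable R : realType.

Definition two_point_free (b : R) (x : int * int) : R :=
  limn (fun r => clean_two_point (@box_adj r) b (box_origin r) (box_vertex r x)).

Definition euclidean_norm (x : int * int) : R :=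
  Num.sqrt (x.1%:~R ^+ 2 + x.2%:~R ^+ 2).

Definition exponential_decay (f : int * int -> R) : Prop :=
  exists C c : R, 0 < c /\
    forall x, `|f x| <= C * expR (- c * euclidean_norm x).

(* Extended-real valued, so that a supremum equal to b%:E means that it is
   finite. *)
Definition beta_BKT : \bar R :=
  ereal_sup [set b%:E | b in
    [set b : R | 0 <= b /\ exponential_decay (two_point_free b)]].

End critical_point.

Section parameters.
Variable R : realType.

Definition dilution_alpha (star : dilution) : nat :=
  match star with Bond => 1 | Site => 2 end.

Definition dilution_kappa (star : dilution) : R :=
  match star with Bond => 1 | Site => 4 end.

Definition dilution_density (star : dilution) (p : R) : R :=
  match star with Bond => 1 | Site => p end.

Definition H_fun (kappa t : R) : R := 1 - expR (- 2 * kappa * t).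

End parameters.

(* Main.v *)
Require Import Defs.
From mathcomp Require Import all_boot all_order all_algebra.
From mathcomp Require Import all_classical all_reals all_analysis.
From mathcomp Require Import measurable_realfun complex.
From mathcomp Require Import ring lra zify.
(** Why the theorem holds.

    Everything is read off the Fourier transform of the Gibbs weight,
    Z(s) = int cos(s . theta) exp(sum_i w_i cos(chi_i . theta)) dtheta, where s
    ranges over integer charges on the vertices and, for the XY model, chi_e is
    the dipole of the edge e.  Expanding the exponential turns Z(s) into a
    nonnegative combination of the numbers N_E(s) of signs on a sequence of
    edges E that add up to -s ([signings]).  For a product of two transforms,
    the variables s + s' and s - s' decouple:
      Z(s) Z(s') = sum_E weight(E) N_E(s + s') N_E(s - s').
    Hence a bilinear inequality between transforms follows from an inequality
    between sign counts for each E ([fourier_quadratic_ge0]).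
    - Ginibre's inequality becomes (N(s + m) - N(s - m))^2 >= 0 ([ginibre]).
    - The Lieb-Rivasseau inequality
      <z_x conj z_z> <= sum_b <z_x conj z_b>_A <z_b conj z_z>, with b outside the
      interior of A, becomes a statement on orientations of a multigraph: follow
      a trail from x until it leaves the interior, and reverse it
      ([signings_boundary], [lieb]).

    Dilution.  Scale by h >= 0 a part C <= kappa of the interaction, C with
    nonnegative coefficients, and let g(h) be a correlation.  Ginibre's
    inequality applied to C and to C^2 gives g'' + 2 kappa g' >= 0, that is, g
    is convex in 1 - exp(-2 kappa h).  Its chord bounds
    2 kappa (g(t) - g(0)) <= (exp(2 kappa t) - 1) g'(t)
    ([corr_chord]).  Apply this to the edges controlled by one bond variable
    (kappa = 1) or by one site variable (kappa = 4, half the sum of two degrees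
    at most 4).  With the derivative of a Bernoulli expectation in its density,
    it shows that the annealed correlation does not decrease along the curve
    q^alpha (1 - exp(-2 kappa t)) = const, which joins a clean model of coupling
    at least b_0 to the given diluted model ([dilution_comparison]).

    Critical point.  For the clean model let Q_k(b) be the sum of the two-point
    function of the box of radius k from its centre to its boundary.  If
    Q_k(b) < 1, iterating the Lieb-Rivasseau inequality gives exponential decay
    ([exponential_decay_of_shell]).  Since Q_k is continuous, Q_k(b_0) < 1 would
    give exponential decay for some b > b_0; so Q_k(b_0) >= 1 for every k >= 1
    ([critical_shell_ge1]).

    Conclusion.  Around a vertex x that is the centre of an embedded box of
    radius r, each of the r concentric shells contributes at least 1 to
    sum_y E <z_x conj z_y>, and y = x contributes the density d
    ([quenched_row_ge]).  Centred boxes of radius R in the square, boxes of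
    radius R/2 around the points of its core, and boxes around all points of the
    torus give the stated bounds.  The susceptibility is beta/2 times the
    structure factor, by differentiation at h = 0 and conservation of the total
    charge ([susceptibilityE]). *)

Set Implicit Arguments.
Unset Strict Implicit.
Unset Printing Implicit Defensive.
Import Order.TTheory GRing.Theory Num.Theory.
Import numFieldNormedType.Exports.
Local Open Scope classical_set_scope.
Local Open Scope ring_scope.

(** * Exponential tilts of bounded observables *)

Section bounded_observables.
Context d (T : measurableType d) (R : realType) (P : probability T R).
Implicit Types (f g F W X : T -> R).

Definition bounded_measurable f :=
  measurable_fun setT f /\ exists M, forall x, `|f x| <= M.

Lemma bm_cst (c : R) : bounded_measurable (fun=> c).
Proof. by split; [exact: measurable_cst | exists `|c|]. Qed.

Lemma bmD f g : bounded_measurable f -> bounded_measurable g ->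
  bounded_measurable (fun x => f x + g x).
Proof.
move=> [mf [M Mf]] [mg [N Ng]]; split; first exact: measurable_funD.
by exists (M + N) => x; rewrite (le_trans (ler_normD _ _))// lerD.
Qed.

Lemma bmM f g : bounded_measurable f -> bounded_measurable g ->
  bounded_measurable (fun x => f x * g x).
Proof.
move=> [mf [M Mf]] [mg [N Ng]]; split; first exact: measurable_funM.
by exists (M * N) => x; rewrite normrM ler_pM.
Qed.

Lemma bm_sum (I : Type) (r : seq I) (f : I -> T -> R) :
  (forall i, bounded_measurable (f i)) ->
  bounded_measurable (fun x => \sum_(i <- r) f i x).
Proof.
move=> bf; elim: r => [|i r ih].
  by under [X in bounded_measurable X]eq_fun do rewrite big_nil; exact: bm_cst.
under [X in bounded_measurable X]eq_fun do rewrite big_cons.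
exact: bmD.
Qed.

Lemma bmX f k : bounded_measurable f -> bounded_measurable (fun x => f x ^+ k).
Proof.
move=> bf; elim: k => [|k ih].
  by under [X in bounded_measurable X]eq_fun do rewrite expr0; exact: bm_cst.
under [X in bounded_measurable X]eq_fun do rewrite exprS.
exact: bmM.
Qed.

Lemma bm_exp f : bounded_measurable f ->
  bounded_measurable (fun x => expR (f x)).
Proof.
move=> [mf [M Mf]]; split; first exact: measurableT_comp.
exists (expR M) => x; rewrite ger0_norm ?expR_ge0// ler_expR.
by rewrite (le_trans (ler_norm _)).
Qed.

Lemma bm_integrable f : bounded_measurable f -> P.-integrable setT (EFin \o f).
Proof.
move=> [mf [M Mf]]; apply: measurable_bounded_integrable => //.
  by apply: (@le_lt_trans _ _ 1%E); [exact: probability_le1 | exact: ltry].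
exists M; split; first exact: num_real.
by move=> N MN x _ /=; rewrite (le_trans (Mf x))// ltW.
Qed.

Lemma Rintegral_sum (I : Type) (r : seq I) (f : I -> T -> R) :
  (forall i, bounded_measurable (f i)) ->
  \int[P]_x (\sum_(i <- r) f i x) = \sum_(i <- r) \int[P]_x f i x.
Proof.
move=> bf; elim: r => [|i r ih].
  under eq_Rintegral do rewrite big_nil.
  by rewrite big_nil Rintegral_cst// mul0r.
under eq_Rintegral do rewrite big_cons.
rewrite big_cons RintegralD// ?ih//; apply: bm_integrable => //.
exact: bm_sum.
Qed.

(** The integrand and its derivative in h are bounded for h within 1 of a, so
    differentiation under the integral is dominated by a constant. *)
Lemma is_derive_exp_tilt F W X (a : R) :
  bounded_measurable F -> bounded_measurable W -> bounded_measurable X ->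
  is_derive a 1 (fun h : R => \int[P]_x (F x * expR (W x + h * X x)))
    (\int[P]_x (F x * X x * expR (W x + a * X x))).
Proof.
move=> bF bW bX.
pose f (h : R) x := F x * expR (W x + h * X x).
have df (x : T) (h : R) : is_derive h (1 : R) (f ^~ x) (F x * X x * expR (W x + h * X x)).
  rewrite /f; apply: is_derive_eq; rewrite /GRing.scale/=; ring.
have d1f (x : T) (h : R) : partial1of2 f h x = F x * X x * expR (W x + h * X x).
  by rewrite partial1of2E derive_val.
have [mF [MF HF]] := bF; have [mW [MW HW]] := bW; have [mX [MX HX]] := bX.
pose G : T -> R := fun=> `|MF| * `|MX| * expR (`|MW| + (`|a| + 1) * `|MX|).
have bf h : bounded_measurable (f h).
  by apply: bmM => //; apply/bm_exp/bmD => //; apply: bmM => //; exact: bm_cst.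
have H : (`]a - 1, a + 1[%classic : set R) a.
  by rewrite /= in_itv/= ltrBlDr ltrDl ltr01.
have intf h : (`]a - 1, a + 1[%classic : set R) h -> P.-integrable setT (EFin \o f h).
  by move=> _; exact: bm_integrable.
have derf h x : (`]a - 1, a + 1[%classic : set R) h -> setT x ->
    derivable (f ^~ x) h 1.
  by move=> _ _; exact: ex_derive.
have G0 x : 0 <= G x by rewrite /G !mulr_ge0// expR_ge0.
have iG : P.-integrable setT (EFin \o G) by apply/bm_integrable/bm_cst.
have Gub h x : (`]a - 1, a + 1[%classic : set R) h -> setT x ->
    `|partial1of2 f h x| <= G x.
  rewrite /= in_itv/= => /andP[h1 h2] _; rewrite d1f /G !normrM.
  have leM (M : R) : M <= `|M| by exact: ler_norm.
  rewrite !ler_pM// ?mulr_ge0//.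
  - by rewrite (le_trans (HF x)).
  - by rewrite (le_trans (HX x)).
  rewrite ger0_norm ?expR_ge0// ler_expR lerD//.
    by rewrite (le_trans (ler_norm _))// (le_trans (HW x)).
  rewrite (le_trans (ler_norm _))// normrM ler_pM//.
    have Na := ler_norm (- a); rewrite normrN in Na.
    have Pa := ler_norm a.
    by rewrite ler_norml; apply/andP; split; lra.
  by rewrite (le_trans (HX x)).
apply: DeriveDef.
  exact: (@derivable_under_integral _ _ _ P f setT measurableT a (a - 1) (a + 1)
     H intf derf G G0 iG Gub).
rewrite -derive1E (@differentiation_under_integral _ _ _ P f setT measurableT a
  (a - 1) (a + 1) H intf derf G G0 iG Gub).
by apply: eq_Rintegral => x _; rewrite d1f.
Qed.

(** Termwise integration of the exponential series of X, whose partial sums are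
    dominated by the exponential of a bound of X. *)
Lemma exp_tilt_series F W X :
  bounded_measurable F -> bounded_measurable W -> bounded_measurable X ->
  (fun n => \sum_(k < n) (k`!%:R)^-1 * \int[P]_x (F x * expR (W x) * X x ^+ k))
    @ \oo --> \int[P]_x (F x * expR (W x + X x)).
Proof.
move=> bF bW bX.
have [mF [MF HF]] := bF; have [mW [MW HW]] := bW; have [mX [MX HX]] := bX.
pose f n x := \sum_(k < n) (k`!%:R)^-1 * (F x * expR (W x) * X x ^+ k).
have bt k : bounded_measurable
    (fun x => (k`!%:R)^-1 * (F x * expR (W x) * X x ^+ k)).
  by apply: bmM (bm_cst _) _; apply: bmM (bmX _ bX); apply: bmM (bm_exp bW).
have bf n : bounded_measurable (f n) by exact: bm_sum.
rewrite (_ : (fun n => _) = (fun n => \int[P]_x f n x)); last first.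
  apply/funext => n; rewrite Rintegral_sum//; apply: eq_bigr => k _.
  rewrite RintegralZl//; apply: bm_integrable.
  by apply: bmM (bmX _ bX); apply: bmM (bm_exp bW).
have fE n x : f n x = F x * expR (W x) * series (exp_coeff (X x)) n.
  rewrite /f /series/= big_mkord mulr_sumr; apply: eq_bigr => k _.
  by rewrite /exp_coeff/= [X in _ = _ * X]mulrC mulrCA.
have b1 : bounded_measurable (fun x => F x * expR (W x + X x)).
  by apply: bmM => //; exact/bm_exp/bmD.
have mf n : measurable_fun setT (EFin \o f n) by apply/measurable_EFinP; case: (bf n).
have ml : measurable_fun setT (EFin \o (fun x => F x * expR (W x + X x))).
  by apply/measurable_EFinP; case: b1.
have cf x : setT x -> (EFin \o f n) x @[n --> \oo] -->
     (EFin \o (fun x => F x * expR (W x + X x))) x.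
  move=> _; apply: cvg_EFin; first exact: nearW.
  rewrite /= expRD mulrA; rewrite (_ : _ \o _ = (fun n => F x * expR (W x) * series (exp_coeff (X x)) n)).
    by apply: cvgMr; exact: is_cvg_series_exp_coeff.
  by apply/funext => n /=; rewrite fE.
pose G : T -> R := fun=> `|MF| * expR `|MW| * expR `|MX|.
have iG : P.-integrable setT (EFin \o G) by apply/bm_integrable/bm_cst.
have Gub x n : setT x -> (`|(EFin \o f n) x| <= (EFin \o G) x)%E.
  move=> _; rewrite /= lee_fin fE !normrM /G !ler_pM// ?mulr_ge0//.
  - by rewrite (le_trans (HF x))// ler_norm.
  - rewrite ger0_norm ?expR_ge0// ler_expR (le_trans (ler_norm _))//.
    by rewrite (le_trans (HW x))// ler_norm.
  rewrite /series/= (le_trans (ler_norm_sum _ _ _))//.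
  rewrite (@le_trans _ _ (series (exp_coeff `|MX|) n))//.
    rewrite /series/=; apply: ler_sum => k _; rewrite /exp_coeff/= normrM normrX.
    rewrite [`|_^-1|]ger0_norm ?invr_ge0// ler_wpM2r ?invr_ge0// lerXn2r ?nnegrE//.
    by rewrite (le_trans (HX x))// ler_norm.
  apply: nondecreasing_cvgn_le; last exact: is_cvg_series_exp_coeff.
  apply: nondecreasing_series => k _ _; rewrite /exp_coeff/=.
  by rewrite mulr_ge0 ?invr_ge0// exprn_ge0.
have [_ _] := @dominated_convergence _ _ _ P setT measurableT
  (fun n => EFin \o f n) _ (EFin \o G) mf ml (aeW _ cf) iG
  (aeW _ (fun x n => Gub x n)).
move=> H; apply: (@fine_cvg _ _ _ _ _ (fine _)).
rewrite fineK//; exact: integrable_fin_num (bm_integrable b1).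
Qed.

End bounded_observables.

(** * Fourier integrals of uniform angles *)

Section fourier_integrals.
Context d (T : measurableType d) (R : realType) (P : probability T R).

Lemma bm_integralE (f : T -> R) : bounded_measurable f ->
  (\int[P]_x (f x)%:E = (\int[P]_x f x)%:E)%E.
Proof.
by move=> bf; rewrite /Rintegral fineK//; exact: integrable_fin_num (bm_integrable P bf).
Qed.

Lemma Rintegral_prob_cst (c : R) : \int[P]_x c = c.
Proof.
rewrite Rintegral_cst// [X in fine X](_ : _ = 1%E) ?mulr1//.
exact: probability_setT.
Qed.

Lemma bm_cos (f : T -> R) : measurable_fun setT f ->
  bounded_measurable (fun x => cos (f x)).
Proof.
move=> mf; split; last by exists 1 => x; exact: cos_max.
apply: (measurableT_comp _ mf).
exact: continuous_measurable_fun (@continuous_cos R).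
Qed.

End fourier_integrals.

Section angle_fourier.
Variable R : realType.

Lemma Rintegral_cos_uniform (n : int) (a : R) :
  \int[angle_prob R]_x cos (n%:~R * x + a) = cos a * (n == 0)%:R.
Proof.
case: eqP => [->|/eqP n0].
  under eq_Rintegral do rewrite mul0r add0r.
  by rewrite mulr1 Rintegral_prob_cst.
rewrite mulr0.
have nR0 : n%:~R != 0 :> R by rewrite intr_eq0.
have mc : measurable_fun setT (fun x : measurableTypeR R => cos (n%:~R * x + a)).
  by apply: (bm_cos _).1; apply: measurable_funD => //; apply: measurable_funM.
have bc := bm_cos (measurable_funD (measurable_funM (measurable_cst (n%:~R : R))
  (@measurable_id _ (measurableTypeR R) setT)) (measurable_cst a)).
(* Adding 1 makes the integrand nonnegative. *)
suff H : \int[angle_prob R]_x (1 + cos (n%:~R * x + a)) = 1.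
  move: H; rewrite RintegralD//; last 2 first.
  - exact: bm_integrable (bm_cst _ 1).
  - exact: bm_integrable bc.
  by rewrite Rintegral_prob_cst => /(congr1 (fun z => z - 1)); rewrite addrAC subrr add0r.
rewrite /Rintegral integral_uniform; last 2 first.
- by apply/measurable_EFinP; apply: measurable_funD.
- by move=> x; rewrite lee_fin -lerBlDl sub0r cos_geN1.
pose F (x : R) := x + n%:~R^-1 * sin (n%:~R * x + a).
have dF (x : R) : is_derive x (1 : R) F (1 + cos (n%:~R * x + a)).
  rewrite /F; apply: is_derive_eq; rewrite /GRing.scale/=.
  by field.
have cF : continuous F.
  by move=> x; apply/differentiable_continuous/derivable1_diffP; exact: ex_derive.
rewrite (@continuous_FTC2 _ _ F).
- rewrite -EFinB; have -> : F (pi *+ 2) - F 0 = pi *+ 2 :> R.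
    rewrite /F mulr0 !add0r.
    suff -> : sin (n%:~R * (pi *+ 2) + a) = sin a :> R by rewrite addrK.
    rewrite addrC; case: n {nR0 n0 mc bc F dF cF} => k.
      by rewrite mulr_natl (periodicn (@sinD2pi R)).
    rewrite NegzE mulrNz mulNr mulr_natl.
    by rewrite -[in RHS](subrK (pi *+ 2 *+ k.+1) a) (periodicn (@sinD2pi R)).
  by rewrite -EFinM/= subr0 mulVf// gt_eqF// two_pi_gt0.
- exact: two_pi_gt0.
- apply: continuous_subspaceT => x.
  have dG : is_derive x (1 : R) (fun x : R => 1 + cos (n%:~R * x + a)) (- (n%:~R * sin (n%:~R * x + a))).
    by apply: is_derive_eq; rewrite /GRing.scale/= ; ring.
  by apply/differentiable_continuous/derivable1_diffP; exact: ex_derive.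
- split.
  + by move=> x _; exact: ex_derive.
  + exact/cvg_at_right_filter/cF.
  + exact/cvg_at_left_filter/cF.
- by move=> x _; rewrite derive1E derive_val.
Qed.

Lemma measurable_phase n (c : 'I_n -> int) :
  measurable_fun setT (fun t : n.-tuple (measurableTypeR R) =>
    \sum_i (c i)%:~R * tnth t i : R).
Proof.
apply: measurable_sum => i; apply: measurable_funM => //.
exact: measurable_tnth.
Qed.

(** The additive phase a carries the induction: once the last coordinates are
    integrated, the first one has only contributed to the phase. *)
Lemma Rintegral_cos_tuple n (c : 'I_n -> int) (a : R) :
  \int[angles_prob R n]_t cos (\sum_i (c i)%:~R * tnth t i + a) =
  cos a * [forall i, c i == 0]%:R.
Proof.
elim: n c a => [|n ih] c a.
  under eq_Rintegral do rewrite big_ord0 add0r.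
  by rewrite Rintegral_prob_cst; case: forallP => [_|[[]//]]; rewrite mulr1.
have bc : bounded_measurable (fun t : n.+1.-tuple (measurableTypeR R) =>
    cos (\sum_i (c i)%:~R * tnth t i + a)).
  apply: bm_cos; apply: measurable_funD => //; exact: measurable_phase.
pose g (z : measurableTypeR R * n.-tuple (measurableTypeR R)) :=
  cos (\sum_i (c i)%:~R * tnth (cons_angle z) i + a).
have bg : bounded_measurable g.
  split; last by exists 1 => z; exact: cos_max.
  exact: (measurableT_comp bc.1 (@measurable_cons_angle R n)).
rewrite /Rintegral/= integral_distribution; last 2 first.
- by apply/measurable_EFinP; exact: bc.1.
- exact: bm_integrable bg.
rewrite -[X in integral X](_ : (angle_prob R \x angles_prob R n)%E = _)//.
rewrite -integral12_prod_meas1; last exact: (bm_integrable _ bg).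
have gE (x : measurableTypeR R) (y : n.-tuple (measurableTypeR R)) : g (x, y) =
   cos (\sum_i (c (lift ord0 i))%:~R * tnth y i + ((c ord0)%:~R * x + a)).
  rewrite /g big_ord_recl /=; congr cos.
  rewrite tnth0 addrCA addrA; congr (_ + _ + _).
  by apply: eq_bigr => i _; rewrite tnthS.
rewrite /fubini_F; under eq_integral => x _.
  under eq_integral => y _ do rewrite /= -[X in X%:E]/(g (x, y)) gE.
  rewrite bm_integralE; last first.
    apply: bm_cos; apply: measurable_funD => //; exact: measurable_phase.
  rewrite ih.
  over.
set b := [forall i, _].
rewrite -/(Rintegral _ _ _) RintegralZr//; last first.
  apply: bm_integrable; apply: bm_cos.
  by apply: measurable_funD => //; apply: measurable_funM.
rewrite Rintegral_cos_uniform -mulrA -natrM mulnb; congr (_ * (nat_of_bool _)%:R).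
apply/andP/forallP => [[c0 /forallP cb] i|cb].
  by case: (unliftP ord0 i) => [j ->|->].
by split; [exact: cb | apply/forallP => i; exact: cb].
Qed.

End angle_fourier.

(** * Cauchy products of nonnegative series *)

Section real_sequences.
Variable R : realType.
Implicit Types (a b : nat -> R).

(** Pascal's rule, in the form of the recursion satisfied by the moments of a sum
    of two independent energies. *)
Lemma binomial_step (f : nat -> nat -> R) k :
  \sum_(i < k.+2) 'C(k.+1, i)%:R * f i (k.+1 - i)%N =
  \sum_(i < k.+1) 'C(k, i)%:R * (f i.+1 (k - i)%N + f i (k - i).+1).
Proof.
rewrite big_ord_recl bin0 mul1r subn0.
under eq_bigr => i _ do rewrite /bump/= binS natrD mulrDl subSS.
under [in RHS]eq_bigr => i _ do rewrite mulrDr.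
rewrite !big_split/= addrA addrC; congr (_ + _).
rewrite big_ord_recr/= bin_small// mul0r addr0 [in RHS]big_ord_recl bin0 mul1r subn0.
congr (_ + _); apply: eq_bigr => i _; rewrite /bump/= add1n.
by rewrite subnSK.
Qed.

Lemma antidiagonal_sum a b n :
  \sum_(k < n) \sum_(i < k.+1) a i * b (k - i)%N =
  \sum_(i < n) \sum_(j < n) (i + j < n)%N%:R * (a i * b j).
Proof.
transitivity (\sum_(k < n) \sum_(i < n) \sum_(j < n) (i + j == k)%N%:R * (a i * b j)).
  apply: eq_bigr => k _.
  rewrite [RHS](bigID (fun i : 'I_n => (i < k.+1)%N))/= [X in _ + X]big1 ?addr0.
    rewrite (big_ord_widen n (fun i => a i * b (k - i)%N))//.
    apply: eq_bigr => i ik.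
    have kin : (k - i < n)%N by rewrite (leq_ltn_trans (leq_subr _ _)).
    rewrite (bigD1 (Ordinal kin))//= big1 ?addr0.
      by rewrite subnKC// eqxx mul1r.
    move=> j jk; case: eqP => [e|]; last by rewrite mul0r.
    by case/eqP: jk; apply/val_inj; rewrite /= -e addKn.
  move=> i; rewrite -leqNgt => ki; rewrite big1// => j _.
  by rewrite gtn_eqF ?mul0r// (leq_trans ki)// leq_addr.
rewrite exchange_big; apply: eq_bigr => i _.
rewrite exchange_big; apply: eq_bigr => j _.
rewrite -mulr_suml; congr (_ * _); case: ltnP => ijn.
  rewrite (bigD1 (Ordinal ijn))//= eqxx big1 ?addr0// => k kij.
  by case: eqP => // e; case/eqP: kij; apply/val_inj.
by rewrite big1// => k _; rewrite gtn_eqF// (leq_trans _ ijn).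
Qed.

(** The partial sums over i + j < n lie between the products of the partial sums of
    length n/2 and of length n. *)
Lemma cvg_series_product a b (A B : R) :
  (forall k, 0 <= a k) -> (forall k, 0 <= b k) ->
  \sum_(k < n) a k @[n --> \oo] --> A ->
  \sum_(k < n) b k @[n --> \oo] --> B ->
  \sum_(k < n) \sum_(i < k.+1) a i * b (k - i)%N @[n --> \oo] --> A * B.
Proof.
move=> a0 b0 cA cB.
pose S n := (\sum_(k < n) a k) * \sum_(k < n) b k.
have cS : S n @[n --> \oo] --> A * B by exact: cvgM.
have cS2 : S n./2 @[n --> \oo] --> A * B.
  apply: (@cvg_comp _ _ _ (fun n : nat => n./2) S _ \oo) cS.
  move=> P [N _ NP]; exists N.*2 => //= n /= Nn; apply: NP => /=.
  by rewrite -(doubleK N) half_leq.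
have SE n m : (m <= n)%N ->
    S m = \sum_(i < n) \sum_(j < n) ((i < m) && (j < m))%N%:R * (a i * b j).
  move=> mn; rewrite /S (big_ord_widen n a)// (big_ord_widen n b)// mulr_suml big_mkcond/=.
  apply: eq_bigr => i _; case: ifP => im /=; last first.
    by rewrite big1// => j _; rewrite mul0r.
  rewrite mulr_sumr big_mkcond/=.
  by apply: eq_bigr => j _; case: ifP; rewrite ?mul1r ?mul0r.
apply: (squeeze_cvgr _ cS2 cS).
apply: nearW => n; rewrite antidiagonal_sum (SE n n)// (SE n n./2); last first.
  by rewrite -{2}(odd_double_half n) -addnn addnA leq_addl.
apply/andP; split; apply: ler_sum => i _; apply: ler_sum => j _.
  rewrite ler_wpM2r ?mulr_ge0// ler_nat; case: andP => // -[im jm].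
  suff -> : (i + j < n)%N by [].
  have h2 : (n./2 + n./2 <= n)%N.
    by rewrite -{3}(odd_double_half n) -addnn leq_addl.
  by rewrite (leq_trans _ h2)// -addnS leq_add// ltnW.
by rewrite ler_wpM2r ?mulr_ge0// ler_nat !ltn_ord; case: ltnP.
Qed.

End real_sequences.

(** * Fourier transform of a Gibbs weight *)

Lemma cos_mul_cos (R : realType) (a b : R) :
  cos a * cos b = (cos (a + b) + cos (a - b)) / 2.
Proof. by rewrite cosD cosB; field. Qed.

Section fourier_transform.
Variables (R : realType) (V I : finType).
Notation charge := {ffun V -> int}.
Variable chi : I -> charge.
Implicit Types (w : I -> R) (s : charge) (X : charge -> R) (t : angles R V).

(** The pairing s . theta of a charge with a configuration of angles. *)
Definition phase t s : R := \sum_v (s v)%:~R * angle t v.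

Lemma phaseD t s s' : phase t (s + s') = phase t s + phase t s'.
Proof.
by rewrite -big_split; apply: eq_bigr => v _; rewrite ffunE intrD mulrDl.
Qed.

Lemma phaseN t s : phase t (- s) = - phase t s.
Proof.
by rewrite -sumrN; apply: eq_bigr => v _; rewrite ffunE mulrNz mulNr.
Qed.

Lemma phaseB t s s' : phase t (s - s') = phase t s - phase t s'.
Proof. by rewrite phaseD phaseN. Qed.

Lemma phaseE t s : phase t s =
  \sum_(i < #|V|) (s (enum_val i))%:~R * tnth t i.
Proof.
rewrite /phase (reindex (@enum_val V predT)); last first.
  exact/onW_bij/enum_val_bij.
by apply: eq_bigr => i _; rewrite /angle enum_valK.
Qed.

Lemma measurable_phaseD s (a : R) : measurable_fun setT (fun t => phase t s + a).
Proof.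
under eq_fun do rewrite phaseE.
by apply: measurable_funD => //; exact: measurable_phase.
Qed.

Lemma Rintegral_cos_phase s (a : R) :
  \int[angles_prob R #|V|]_t cos (phase t s + a) = cos a * (s == 0)%:R.
Proof.
under eq_Rintegral do rewrite phaseE.
rewrite (@Rintegral_cos_tuple R #|V| (fun i => s (enum_val i)) a).
congr (_ * (nat_of_bool _)%:R); apply/forallP/eqP => [s0|-> i].
  by apply/ffunP => v; rewrite ffunE -[v]enum_rankK; apply/eqP.
by rewrite ffunE.
Qed.

Definition energy w t : R := \sum_i w i * cos (phase t (chi i)).

(** The phase a also covers sines, at a = - pi / 2. *)
Definition fourier_shift w (a : R) s : R :=
  \int[angles_prob R #|V|]_t (cos (phase t s + a) * expR (energy w t)).

Definition fourier w s : R :=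
  \int[angles_prob R #|V|]_t (cos (phase t s) * expR (energy w t)).

(** Multiplication by the energy, seen on Fourier transforms: it moves the charge by
    plus or minus one of the chi i. *)
Definition hop w X s : R :=
  \sum_i w i / 2 * (X (s + chi i) + X (s - chi i)).

Lemma bm_cos_phase s (a : R) : bounded_measurable (fun t => cos (phase t s + a)).
Proof. apply: bm_cos. exact: measurable_phaseD. Qed.

Lemma bm_energy w : bounded_measurable (energy w).
Proof.
apply: bm_sum => i; apply: bmM; first exact: bm_cst.
under eq_fun do rewrite -[phase _ _]addr0; exact: bm_cos_phase.
Qed.

Lemma energyD w0 w1 t : energy (fun i => w0 i + w1 i) t = energy w0 t + energy w1 t.
Proof. by rewrite /energy -big_split; apply: eq_bigr => i _; rewrite mulrDl. Qed.

Lemma energyZ (h : R) w t : energy (fun i => h * w i) t = h * energy w t.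
Proof. by rewrite /energy mulr_sumr; apply: eq_bigr => i _; rewrite mulrA. Qed.

Lemma Rintegral_cos_energy (G : angles R V -> R) w (a : R) s :
  bounded_measurable G ->
  \int[angles_prob R #|V|]_t (cos (phase t s + a) * energy w t * G t) =
  hop w (fun s => \int[angles_prob R #|V|]_t (cos (phase t s + a) * G t)) s.
Proof.
move=> bG; have bc s' : bounded_measurable (fun t => cos (phase t s' + a) * G t).
  by apply: bmM => //; exact: bm_cos_phase.
transitivity (\int[angles_prob R #|V|]_t (\sum_i w i / 2 *
   (cos (phase t (s + chi i) + a) * G t + cos (phase t (s - chi i) + a) * G t))).
  apply: eq_Rintegral => t _; rewrite mulr_sumr mulr_suml; apply: eq_bigr => i _.
  rewrite mulrCA -mulrA [cos _ * cos _](cos_mul_cos (phase t s + a)) phaseD phaseB.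
  by rewrite (addrAC _ (phase t (chi i))) (addrAC _ (- _)); field.
rewrite Rintegral_sum => [|i]; last first.
  by apply: bmM; [exact: bm_cst | exact: bmD].
apply: eq_bigr => i _; rewrite RintegralZl//; last first.
  by apply: bm_integrable; exact: bmD.
by rewrite RintegralD//; exact: bm_integrable.
Qed.

Lemma Rintegral_cos_energyX (G : angles R V -> R) w (a : R) s k :
  bounded_measurable G ->
  \int[angles_prob R #|V|]_t (cos (phase t s + a) * G t * energy w t ^+ k) =
  iter k (hop w) (fun s => \int[angles_prob R #|V|]_t (cos (phase t s + a) * G t)) s.
Proof.
elim: k s G => [|k ih] s G bG /=.
  by apply: eq_Rintegral => t _; rewrite expr0 mulr1.
transitivity (\int[angles_prob R #|V|]_t (cos (phase t s + a) * energy w t *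
    (G t * energy w t ^+ k))).
  by apply: eq_Rintegral => t _; rewrite exprS; ring.
rewrite Rintegral_cos_energy; last by apply: bmM => //; exact/bmX/bm_energy.
congr hop; apply/funext => s'; rewrite -ih//.
by apply: eq_Rintegral => t _; rewrite mulrA.
Qed.

(** Expansion of the part w1 of the energy around the Gibbs weight of w0; w0 = 0
    gives the expansion around the uniform measure. *)
Lemma cvg_fourier_shift w0 w1 (a : R) s :
  \sum_(k < n) (k`!%:R)^-1 * iter k (hop w1) (fourier_shift w0 a) s @[n --> \oo]
    --> fourier_shift (fun i => w0 i + w1 i) a s.
Proof.
have := @exp_tilt_series _ _ R (angles_prob R #|V|) _ _ _ (bm_cos_phase s a) (bm_energy w0)
  (bm_energy w1).
rewrite /fourier_shift; under [in X in _ -> X]eq_Rintegral do rewrite energyD.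
apply: cvg_trans; apply: near_eq_cvg; apply: nearW => n.
apply: eq_bigr => k _; congr (_ * _).
by rewrite Rintegral_cos_energyX//; exact/bm_exp/bm_energy.
Qed.

Lemma fourier_shift0 w : fourier_shift w 0 = fourier w.
Proof.
by apply/funext => s; apply: eq_Rintegral => t _; rewrite addr0.
Qed.

Lemma cvg_fourier w0 w1 s :
  \sum_(k < n) (k`!%:R)^-1 * iter k (hop w1) (fourier w0) s @[n --> \oo]
    --> fourier (fun i => w0 i + w1 i) s.
Proof. by rewrite -!fourier_shift0; exact: cvg_fourier_shift. Qed.

Lemma fourier_shift_free (a : R) s :
  fourier_shift (fun=> 0) a s = cos a * (s == 0)%:R.
Proof.
rewrite -Rintegral_cos_phase; apply: eq_Rintegral => t _.
by rewrite /energy big1 ?expR0 ?mulr1// => i _; rewrite mul0r.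
Qed.

Lemma fourier_free s : fourier (fun=> 0) s = (s == 0)%:R.
Proof. by rewrite -fourier_shift0 fourier_shift_free cos0 mul1r. Qed.

Lemma hopZ w (c : R) X : hop w (fun s => c * X s) = (fun s => c * hop w X s).
Proof.
apply/funext => s; rewrite /hop mulr_sumr; apply: eq_bigr => i _; ring.
Qed.

(** The sine part of a Fourier coefficient vanishes: it does at zero coupling, and
    hopping is linear. *)
Lemma fourier_shiftE w (a : R) s : fourier_shift w a s = cos a * fourier w s.
Proof.
have itZ k X : iter k (hop w) (fun s => cos a * X s) =
    (fun s => cos a * iter k (hop w) X s).
  by elim: k => //= k ->; rewrite hopZ.
have w0 : (fun i => 0 + w i) = w by apply/funext => i; rewrite add0r.
have := @cvg_fourier_shift (fun=> 0) w a s; rewrite w0.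
have := @cvg_fourier (fun=> 0) w s; rewrite w0 => H1 H2.
rewrite -(cvg_lim (@Rhausdorff R) H2); apply: cvg_lim; first exact: Rhausdorff.
rewrite (_ : (fun n => _) = (fun n => cos a *
  \sum_(k < n) (k`!%:R)^-1 * iter k (hop w) (fourier (fun=> 0)) s)).
  exact: cvgMr.
apply/funext => n; rewrite mulr_sumr; apply: eq_bigr => k _.
rewrite (_ : fourier_shift _ _ = (fun s => cos a * fourier (fun=> 0) s)).
  by rewrite itZ mulrCA.
by apply/funext => s'; rewrite fourier_shift_free fourier_free.
Qed.

Lemma is_derive_fourier w0 w1 s (h : R) :
  is_derive h (1 : R) (fun h => fourier (fun i => w0 i + h * w1 i) s)
    (hop w1 (fourier (fun i => w0 i + h * w1 i)) s).
Proof.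
have := is_derive_exp_tilt (angles_prob R #|V|) h (bm_cos_phase s 0)
  (bm_energy w0) (bm_energy w1).
rewrite -(fourier_shift0 (fun i => _ + _)) /fourier_shift.
rewrite -Rintegral_cos_energy; last exact/bm_exp/bm_energy.
congr is_derive.
  apply/funext => h'; apply: eq_Rintegral => t _.
  by rewrite addr0 energyD energyZ.
by apply: eq_Rintegral => t _; rewrite energyD energyZ.
Qed.

End fourier_transform.

(** * Sign counts and Ginibre's inequality *)

Section signings.
Variables (R : realType) (V I : finType).
Notation charge := {ffun V -> int}.
Variable chi : I -> charge.
Implicit Types (w : I -> R) (s m : charge) (E : seq I).

(** The number of signs on the sequence E for which the signed sum of the chi i
    cancels s. *)
Fixpoint signings E s : nat :=
  if E is i :: E' then (signings E' (s + chi i)%R + signings E' (s - chi i)%R)%N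
  else (s == 0).

Lemma signingsN E s : signings E (- s) = signings E s.
Proof.
elim: E s => [|i E ih] s /=; first by rewrite oppr_eq0.
have -> : - s + chi i = - (s - chi i) by rewrite opprB addrC.
by rewrite -opprD !ih addnC.
Qed.

Fixpoint walk_sum w k (F : seq I -> R) : R :=
  if k is k'.+1 then \sum_i w i / 2 * walk_sum w k' (fun E => F (i :: E))
  else F [::].

Lemma walk_sum_linear w k (J : Type) (r : seq J) (c : J -> R) (F : J -> seq I -> R) :
  walk_sum w k (fun E => \sum_(j <- r) c j * F j E) =
  \sum_(j <- r) c j * walk_sum w k (F j).
Proof.
elim: k F => [//|k ih] F /=.
under eq_bigr => i _ do rewrite ih mulr_sumr.
rewrite exchange_big; apply: eq_bigr => j _.
by rewrite mulr_sumr; apply: eq_bigr => i _; rewrite mulrCA.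
Qed.

Lemma walk_sum_ge0 w k F : (forall i, 0 <= w i) -> (forall E, 0 <= F E) ->
  0 <= walk_sum w k F.
Proof.
move=> w0; elim: k F => [|k ih] F F0 /=; first exact: F0.
by apply: sumr_ge0 => i _; rewrite mulr_ge0 ?divr_ge0 ?ih.
Qed.

Lemma walk_sumD w k (F G : seq I -> R) :
  walk_sum w k (fun E => F E + G E) = walk_sum w k F + walk_sum w k G.
Proof.
elim: k F G => [//|k ih] F G /=.
by rewrite -big_split; apply: eq_bigr => i _; rewrite ih mulrDr.
Qed.

(** The k-th moment of the energy against cos(s . theta), for uniform angles. *)
Definition free_moment w k s : R := iter k (hop chi w) (fun s => (s == 0)%:R) s.

Lemma free_momentE w k s :
  free_moment w k s = walk_sum w k (fun E => (signings E s)%:R).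
Proof.
rewrite /free_moment; elim: k s => [//|k ih] s /=.
apply: eq_bigr => i _; rewrite !ih -walk_sumD; congr (_ * walk_sum _ _ _).
by apply/funext => E; rewrite natrD.
Qed.

Lemma free_moment_ge0 w k s : (forall i, 0 <= w i) -> 0 <= free_moment w k s.
Proof. by move=> w0; rewrite free_momentE walk_sum_ge0. Qed.

(** Two independent copies decouple in the variables s + s' and s - s': moving s or
    s' by plus or minus chi i realises all four sign pairs on these two charges. *)
Lemma free_moment_convolution w k s s' :
  \sum_(i < k.+1) 'C(k, i)%:R * (free_moment w i s * free_moment w (k - i) s') =
  walk_sum w k (fun E => (signings E (s + s'))%:R * (signings E (s - s'))%:R).
Proof.
elim: k s s' => [|k ih] s s'.
  rewrite big_ord1 bin0 mul1r subnn /free_moment /= -!natrM !mulnb.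
  congr (nat_of_bool _)%:R; apply/andP/andP => -[/eqP a /eqP b].
    by rewrite a b addr0 subrr eqxx.
  suff s0 : s = 0 by move: a; rewrite s0 add0r eqxx => ->.
  apply/ffunP => v; move/ffunP/(_ v): a; move/eqP: b; rewrite subr_eq0 => /eqP <-.
  by rewrite !ffunE -mulr2n => /eqP; rewrite mulrn_eq0 => /eqP.
rewrite (binomial_step (fun i j => free_moment w i s * free_moment w j s')).
transitivity (\sum_(i < k.+1) \sum_e w e / 2 * ('C(k, i)%:R *
   (free_moment w i (s + chi e) * free_moment w (k - i) s') +
   'C(k, i)%:R * (free_moment w i (s - chi e) * free_moment w (k - i) s') +
   'C(k, i)%:R * (free_moment w i s * free_moment w (k - i) (s' + chi e)) +
   'C(k, i)%:R * (free_moment w i s * free_moment w (k - i) (s' - chi e)))).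
  apply: eq_bigr => i _; rewrite {1}/free_moment iterS -/(free_moment _ _) /hop.
  rewrite [free_moment w (k - i).+1 s']/free_moment iterS -/(free_moment _ _) /hop.
  rewrite mulr_suml mulr_sumr -big_split mulr_sumr; apply: eq_bigr => e _ /=.
  by rewrite -!/(free_moment _ _ _); ring.
rewrite exchange_big; apply: eq_bigr => e _; rewrite -mulr_sumr !big_split/=.
rewrite !ih -!walk_sumD; congr (_ * walk_sum _ _ _); apply/funext => E.
have e1 : s + chi e + s' = s + s' + chi e by rewrite addrAC.
have e2 : s + chi e - s' = s - s' + chi e by rewrite addrAC.
have e3 : s - chi e + s' = s + s' - chi e by rewrite addrAC.
have e4 : s - chi e - s' = s - s' - chi e by rewrite addrAC.
rewrite e1 e2 e3 e4 !addrA !opprD !opprK !addrA !natrD; ring.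
Qed.

Lemma cvg_free_moment w s :
  \sum_(k < n) (k`!%:R)^-1 * free_moment w k s @[n --> \oo] --> fourier chi w s.
Proof.
have := @cvg_fourier _ _ _ chi (fun=> 0) w s.
have -> : (fun i => 0 + w i) = w by apply/funext => i; rewrite add0r.
by have -> : fourier chi (fun=> 0) = (fun s => (s == 0)%:R) :> (charge -> R) by
  apply/funext => ?; exact: fourier_free.
Qed.

Lemma cvg_fourier_product w s s' : (forall i, 0 <= w i) ->
  \sum_(k < n) (k`!%:R)^-1 * walk_sum w k
     (fun E => (signings E (s + s'))%:R * (signings E (s - s'))%:R) @[n --> \oo]
  --> fourier chi w s * fourier chi w s'.
Proof.
move=> w0.
have t0 s1 k : 0 <= (k`!%:R)^-1 * free_moment w k s1.
  by rewrite mulr_ge0 ?invr_ge0 ?free_moment_ge0.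
have := cvg_series_product (t0 s) (t0 s') (@cvg_free_moment w s) (@cvg_free_moment w s').
apply: cvg_trans; apply: near_eq_cvg; apply: nearW => n.
apply: eq_bigr => k _; rewrite -free_moment_convolution mulr_sumr.
apply: eq_bigr => i _.
have ik : (i <= k)%N by rewrite -ltnS.
have fk : k`!%:R = 'C(k, i)%:R * (i`!%:R * (k - i)`!%:R) :> R.
  by rewrite -!natrM bin_fact.
rewrite fk; field.
by rewrite !pnatr_eq0 -!lt0n !fact_gt0 bin_gt0 ik.
Qed.

(** Both copies see the same sequence E, so a bilinear form in the Fourier
    transform is nonnegative as soon as it is so on sign counts, E by E. *)
Lemma fourier_quadratic_ge0 w (r : seq (R * charge * charge)) :
  (forall i, 0 <= w i) ->
  (forall E, 0 <= \sum_(x <- r) x.1.1 *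
     ((signings E (x.1.2 + x.2))%:R * (signings E (x.1.2 - x.2))%:R)) ->
  0 <= \sum_(x <- r) x.1.1 * (fourier chi w x.1.2 * fourier chi w x.2).
Proof.
move=> w0 H.
pose S n : R := \sum_(x <- r) x.1.1 * \sum_(k < n) (k`!%:R)^-1 * walk_sum w k
  (fun E => (signings E (x.1.2 + x.2))%:R * (signings E (x.1.2 - x.2))%:R).
have cS : S n @[n --> \oo] -->
    \sum_(x <- r) x.1.1 * (fourier chi w x.1.2 * fourier chi w x.2).
  rewrite /S; elim: r {H S} => [|x r ih].
    by rewrite big_nil; under eq_fun do rewrite big_nil; exact: cvg_cst.
  rewrite big_cons; under eq_fun do rewrite big_cons.
  by apply: cvgD => //; apply: cvgMr; exact: cvg_fourier_product.
rewrite -(cvg_lim (@Rhausdorff R) cS); apply: limr_ge; first by apply/cvg_ex; eexists; exact: cS.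
apply: nearW => n; rewrite /S.
under eq_bigr do rewrite mulr_sumr.
rewrite exchange_big; apply: sumr_ge0 => k _.
under eq_bigr do rewrite mulrCA.
rewrite -mulr_sumr mulr_ge0 ?invr_ge0// -walk_sum_linear.
exact: walk_sum_ge0.
Qed.

Lemma fourierN w s : fourier chi w (- s) = fourier chi w s.
Proof. by apply: eq_Rintegral => t _; rewrite phaseN cosN. Qed.

Lemma fourier_ge0 w s : (forall i, 0 <= w i) -> 0 <= fourier chi w s.
Proof.
move=> w0; have c := @cvg_free_moment w s.
rewrite -(cvg_lim (@Rhausdorff R) c); apply: limr_ge.
  by apply/cvg_ex; eexists; exact: c.
apply: nearW => n; apply: sumr_ge0 => k _.
by rewrite mulr_ge0 ?invr_ge0 ?free_moment_ge0.
Qed.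

Lemma fourier0_gt0 w : (forall i, 0 <= w i) -> 0 < fourier chi w 0.
Proof.
move=> w0; have c := @cvg_free_moment w 0.
have H n : (0 < n)%N -> 1 <= \sum_(k < n) (k`!%:R)^-1 * free_moment w k 0.
  case: n => // n _.
  have e0 : free_moment w 0 0 = 1 by rewrite /free_moment /= eqxx.
  rewrite big_ord_recl e0 fact0 invr1 mul1r.
  rewrite lerDl; apply: sumr_ge0 => k _.
  by rewrite mulr_ge0 ?invr_ge0 ?free_moment_ge0.
apply: (@lt_le_trans _ _ 1) => //.
rewrite -(cvg_lim (@Rhausdorff R) c); apply: limr_ge.
  by apply/cvg_ex; eexists; exact: c.
by near=> n; apply: H; near: n; exact: nbhs_infty_gt.
Unshelve. all: by end_near. Qed.

(** On sign counts the difference of the two sides is the square of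
    N(s + m) - N(s - m). *)
Lemma ginibre w s m : (forall i, 0 <= w i) ->
  2 * (fourier chi w s * fourier chi w m) <=
  (fourier chi w (s + m) + fourier chi w (s - m)) * fourier chi w 0.
Proof.
move=> w0.
have := @fourier_quadratic_ge0 w [:: (1, s + m, 0); (1, s - m, 0); (-2, s, m)] w0.
rewrite !big_cons !big_nil /= => H; rewrite -subr_ge0.
apply: le_trans (H _) _; last by rewrite le_eqVlt; apply/orP; left; apply/eqP; ring.
move=> E; rewrite !big_cons !big_nil /= !subr0 !addr0.
have := sqr_ge0 ((signings E (s + m))%:R - (signings E (s - m))%:R : R); lra.
Qed.

End signings.

(** * The Lieb-Rivasseau inequality *)

Ltac charge_ring :=
  let v := fresh "v" in apply/ffunP => v; rewrite ?mulr2n !ffunE; ring.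

Section edge_charges.
Variable V : finType.
Notation charge := {ffun V -> int}.
Implicit Types (s m : charge) (E : seq (V * V)) (x : V).

Definition unit_charge x : charge := [ffun v => (v == x)%:R].

Definition dipole (e : V * V) : charge := unit_charge e.1 - unit_charge e.2.

Local Notation signings := (signings dipole).

Lemma dipoleE (e : V * V) v : dipole e v = (v == e.1)%:R - (v == e.2)%:R.
Proof. by rewrite !ffunE. Qed.

(** The moves of a walker at x along an edge of E, which is then deleted; their number
    is the degree of x in the multigraph E, loops not counted. *)
Fixpoint steps E x : seq (V * seq (V * V)) :=
  if E is e :: E' then
    (if (e.1 == x) && (e.2 != x) then [:: (e.2, E')]
     else if (e.2 == x) && (e.1 != x) then [:: (e.1, E')] else [::])
    ++ [seq (y.1, e :: y.2) | y <- steps E' x]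
  else [::].

Lemma size_steps E x y : y \in steps E x -> (size y.2 < size E)%N.
Proof.
elim: E y => [//|e E ih] y /=; rewrite mem_cat => /orP[|/mapP[z zE ->]/=].
  by do 2?[case: ifP => _]; rewrite ?inE// => /eqP ->.
by rewrite ltnS; exact: ih.
Qed.

(** Read a signing as an orientation.  The charge at x fixes the number of edges that
    leave x to half of degree plus charge; count the pairs of an orientation and an
    edge leaving x, then delete that edge. *)
Lemma steps_balance E s x :
  2 * \sum_(y <- steps E x)
    (signings y.2 (s - unit_charge x + unit_charge y.1))%:Z =
  ((size (steps E x))%:Z + s x) * (signings E s)%:Z.
Proof.
elim: E s => [|e E ih] s.
  rewrite big_nil mulr0 add0r /=; case: eqP => [->|]; last by rewrite mulr0.
  by rewrite ffunE mul0r.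
rewrite /= big_cat/= big_map/= size_cat size_map.
have -> : \sum_(y <- steps E x) (signings y.2 (s - unit_charge x + unit_charge y.1 + dipole e)%R
    + signings y.2 (s - unit_charge x + unit_charge y.1 - dipole e)%R)%N%:Z =
  \sum_(y <- steps E x) (signings y.2 (s + dipole e - unit_charge x + unit_charge y.1))%:Z +
  \sum_(y <- steps E x) (signings y.2 (s - dipole e - unit_charge x + unit_charge y.1))%:Z.
  rewrite -big_split; apply: eq_bigr => y _; rewrite PoszD.
  by congr (Posz (signings _ _) + Posz (signings _ _)); charge_ring.
rewrite !mulrDr !ih.
have eP : (s + dipole e) x = s x + dipole e x by rewrite ffunE.
have eN : (s - dipole e) x = s x - dipole e x by rewrite !ffunE.
rewrite eP eN dipoleE (eq_sym x e.1) (eq_sym x e.2) !PoszD.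
case: (eqVneq e.1 x) => [e1|e1]; case: (eqVneq e.2 x) => [e2|e2] /=.
- by rewrite big_nil subrr; ring.
- rewrite big_seq1/=.
  have -> : s - unit_charge x + unit_charge e.2 = s - dipole e.
    by rewrite /dipole e1 opprB addrA addrAC.
  ring.
- rewrite big_seq1/=.
  have -> : s - unit_charge x + unit_charge e.1 = s + dipole e.
    by rewrite /dipole e2 addrA addrAC.
  ring.
- by rewrite big_nil subrr; ring.
Qed.

(** Follow a trail from x until it leaves S, and reverse it.  One step deletes an
    edge at x; with charge 1 or -1 at x, [steps_balance] has the same coefficient
    for the trail and for its reversal, so the induction on the edges closes. *)
Lemma signings_boundary E (S : {set V}) s x :
  (forall v, v \in S -> s v = 0) ->
  (signings E (s + unit_charge x)%R <=
   \sum_(b | b \notin S)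
      signings E (s - unit_charge x + unit_charge b *+ 2)%R)%N.
Proof.
move: {2}(size E).+1 (ltnSn (size E)) => n; elim: n E s x => [//|n ih] E s x.
rewrite ltnS => En s0; have [xS|xS] := boolP (x \in S); last first.
  rewrite (bigD1 x)//= mulr2n addrA subrK leq_addr//.
have key b : b \notin S ->
  2 * \sum_(y <- steps E x) (signings y.2 (s - unit_charge y.1 + unit_charge b *+ 2))%:Z
  = ((size (steps E x))%:Z + 1) *
    (signings E (s - unit_charge x + unit_charge b *+ 2))%:Z.
  move=> bS; rewrite -(signingsN dipole E).
  have bx : x != b by apply: contraNneq bS => <-.
  have := steps_balance E (- (s - unit_charge x + unit_charge b *+ 2)) x.
  have -> : (- (s - unit_charge x + unit_charge b *+ 2)) x = 1.
    by rewrite mulr2n !ffunE (negPf bx) eqxx (s0 _ xS).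
  move=> <-; congr (2 * _); apply: eq_bigr => y _; rewrite -[in LHS](signingsN dipole); congr Posz; congr signings.
  by charge_ring.
have keyx : 2 * \sum_(y <- steps E x) (signings y.2 (s + unit_charge y.1))%:Z
  = ((size (steps E x))%:Z + 1) * (signings E (s + unit_charge x))%:Z.
  have := steps_balance E (s + unit_charge x) x.
  have -> : (s + unit_charge x) x = 1 by rewrite !ffunE eqxx (s0 _ xS).
  by move=> <-; congr (2 * _); apply: eq_bigr => y _; rewrite addrK.
rewrite -lez_nat -(ler_pM2l (_ : 0 < (size (steps E x))%:Z + 1))//.
rewrite -keyx (big_morph Posz PoszD (erefl (Posz 0))) [X in _ <= X]mulr_sumr.
under [X in _ <= X]eq_bigr => b bS do rewrite -key//.
rewrite -mulr_sumr ler_pM2l// exchange_big/= big_seq [X in _ <= X]big_seq.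
apply: ler_sum => y yE.
rewrite -(big_morph Posz PoszD (erefl (Posz 0))) lez_nat; apply: ih => //.
by rewrite (leq_trans (size_steps yE)).
Qed.

End edge_charges.

Section lieb.
Variables (R : realType) (V : finType).
Notation charge := {ffun V -> int}.
Implicit Types (w : V * V -> R) (s m : charge) (x z : V).
Local Notation Z := (fourier (@dipole V)).

(** On sign counts both sides share the factor N(delta_x - m); what remains is
    [signings_boundary] for the charge - m. *)
Lemma rivasseau w (S : {set V}) x m : (forall e, 0 <= w e) ->
  (forall v, v \in S -> m v = 0) ->
  Z w (unit_charge x - m) * Z w 0 <=
  \sum_(b | b \notin S)
     Z w (unit_charge x - unit_charge b) * Z w (unit_charge b - m).
Proof.
move=> w0 m0.
pose r := (-1, unit_charge x - m, 0) ::
  [seq (1 : R, unit_charge x - unit_charge b, unit_charge b - m)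
   | b <- enum [pred b | b \notin S]].
have := @fourier_quadratic_ge0 R V _ (@dipole V) w r w0.
move=> pos; rewrite -subr_ge0; apply: le_trans (pos _) _ => [E|]; last first.
  rewrite /r big_cons big_map big_enum/= mulN1r [leLHS]addrC.
  by under eq_bigr do rewrite mul1r.
rewrite /r big_cons big_map big_enum/= subr0 addr0 mulN1r.
rewrite [leRHS]addrC subr_ge0.
have H := signings_boundary E x (_ : forall v, v \in S -> (- m) v = 0).
have {}H : (signings (@dipole V) E (unit_charge x - m)%R <= \sum_(b | b \notin S)
   signings (@dipole V) E (unit_charge x - unit_charge b - (unit_charge b - m))%R)%N.
  rewrite (addrC (unit_charge x)); apply: leq_trans (H _) _.
    by move=> v vS; rewrite ffunE m0.
  apply: leq_sum => b _; rewrite -signingsN; apply/eq_leq; congr signings.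
  by charge_ring.
apply: (@le_trans _ _ ((signings (@dipole V) E (unit_charge x - m))%:R *
  (\sum_(b | b \notin S) signings (@dipole V) E
     (unit_charge x - unit_charge b - (unit_charge b - m))%R)%:R)).
  by rewrite ler_wpM2l// ler_nat.
rewrite natr_sum mulr_sumr; apply: ler_sum => b _; rewrite mul1r.
by rewrite addrA subrK.
Qed.

(** Expand the energy wC: its edges avoid S, so each hop only modifies the charge m
    of [rivasseau] outside S and preserves the inequality. *)
Lemma lieb (wA wC : V * V -> R) (S : {set V}) x z : (forall e, 0 <= wA e) ->
  (forall e, 0 <= wC e) ->
  (forall e, (e.1 \in S) || (e.2 \in S) -> wC e = 0) -> z \notin S ->
  Z (fun e => wA e + wC e) (unit_charge x - unit_charge z) * Z wA 0 <=
  \sum_(b | b \notin S) Z wA (unit_charge x - unit_charge b) *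
     Z (fun e => wA e + wC e) (unit_charge b - unit_charge z).
Proof.
move=> wA0 wC0 wCS zS.
(* The inequality of [rivasseau], with one transform replaced by X: it is stable
   under hopping along wC. *)
pose hyp (X : charge -> R) := forall m, (forall v, v \in S -> m v = 0) ->
  X (unit_charge x - m) * Z wA 0 <=
  \sum_(b | b \notin S) Z wA (unit_charge x - unit_charge b) * X (unit_charge b - m).
have hyp0 : hyp (Z wA) by move=> m m0; exact: rivasseau.
have hyp_hop X : hyp X -> hyp (hop (@dipole V) wC X).
  move=> hX m m0; rewrite /hop mulr_suml.
  under [X in _ <= X]eq_bigr do rewrite mulr_sumr.
  rewrite exchange_big; apply: ler_sum => e _.
  have [eS|eS] := boolP ((e.1 \in S) || (e.2 \in S)).
    by rewrite wCS// !mul0r big1// => b _; rewrite !mul0r mulr0.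
  have de v : v \in S -> dipole e v = 0.
    move=> vS; rewrite dipoleE; move: eS; rewrite negb_or => /andP[e1 e2].
    have v1 : v != e.1 by apply: contraTneq vS => ->.
    have v2 : v != e.2 by apply: contraTneq vS => ->.
    by rewrite (negPf v1) (negPf v2).
  under [X in _ <= X]eq_bigr do rewrite mulrCA mulrDr.
  rewrite -mulr_sumr -mulrA ler_wpM2l ?divr_ge0// mulrDl big_split/=.
  have shift y : y - m + dipole e = y - (m - dipole e) /\ y - m - dipole e = y - (m + dipole e).
    by split; charge_ring.
  rewrite (shift (unit_charge x)).1 (shift (unit_charge x)).2.
  under eq_bigr do rewrite (shift _).1.
  under [X in _ <= _ + X]eq_bigr do rewrite (shift _).2.
  apply: lerD; apply: hX => v vS; rewrite [LHS]ffunE m0//.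
    by rewrite [X in 0 + X]ffunE de// oppr0.
  by rewrite de.
have hyp_iter k : hyp (iter k (hop (@dipole V) wC) (Z wA)).
  by elim: k => //= k; exact: hyp_hop.
pose c s n : R := \sum_(k < n) (k`!%:R)^-1 * iter k (hop (@dipole V) wC) (Z wA) s.
have cc s : c s n @[n --> \oo] --> Z (fun e => wA e + wC e) s by exact: cvg_fourier.
have c1 : (c (unit_charge x - unit_charge z) n * Z wA 0) @[n --> \oo] -->
   Z (fun e => wA e + wC e) (unit_charge x - unit_charge z) * Z wA 0.
  by apply: cvgMl; exact: cc.
have c2 : (\sum_(b | b \notin S) Z wA (unit_charge x - unit_charge b) *
    c (unit_charge b - unit_charge z) n) @[n --> \oo] -->
  \sum_(b | b \notin S) Z wA (unit_charge x - unit_charge b) *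
     Z (fun e => wA e + wC e) (unit_charge b - unit_charge z).
  by apply: cvg_big => [|b _]; [exact: add_continuous|]; apply: cvgMr; exact: cc.
apply: ler_cvg_to c1 c2 _; apply: nearW => n.
rewrite /c mulr_suml; under [X in _ <= X]eq_bigr do rewrite mulr_sumr.
rewrite exchange_big; apply: ler_sum => k _.
under [X in _ <= X]eq_bigr do rewrite mulrCA.
rewrite -mulr_sumr -mulrA ler_wpM2l ?invr_ge0//; apply: hyp_iter => v vS.
have vz : v != z by apply: contraTneq vS => ->.
by rewrite ffunE (negPf vz).
Qed.

End lieb.

(** * Correlations as functions of the couplings *)

Lemma le_of_is_derive (R : realType) (f df : R -> R) (a b : R) : a <= b ->
  (forall x, a <= x <= b -> is_derive x (1 : R) f (df x)) ->
  (forall x, a <= x <= b -> 0 <= df x) -> f a <= f b.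
Proof.
move=> ab fD df0.
apply: (@ger0_derive1_le_cc _ f a b) => //; rewrite ?in_itv/= ?lexx ?ab//.
- move=> x; rewrite in_itv/= => /andP[ax xb].
  by have [] : is_derive x (1 : R) f (df x) by apply: fD; rewrite !ltW.
- move=> x; rewrite in_itv/= => /andP[ax xb]; rewrite derive1E.
  have D : is_derive x (1 : R) f (df x) by apply: fD; rewrite !ltW.
  by rewrite derive_val df0// !ltW.
- apply: derivable_within_continuous => x; rewrite in_itv/= => xab.
  by have [] : is_derive x (1 : R) f (df x) by exact: fD.
Qed.

Lemma is_derive_bigsum (R : realType) (J : Type) (r : seq J) (P : pred J)
    (f : J -> R -> R) (df : J -> R) (x : R) :
  (forall j, is_derive x (1 : R) (f j) (df j)) ->
  is_derive x (1 : R) (fun y => \sum_(j <- r | P j) f j y) (\sum_(j <- r | P j) df j).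
Proof.
move=> fD; rewrite -fct_sumE; elim/big_ind2: _ => // *.
  exact: is_derive_cst.
exact: is_deriveD.
Qed.

Section correlations.
Variables (R : realType) (V I : finType).
Notation charge := {ffun V -> int}.
Variable chi : I -> charge.
Implicit Types (w : I -> R) (s m : charge).
Local Notation Z := (fourier chi).

(** The Gibbs mean of cos(s . theta). *)
Definition corr w s : R := Z w s / Z w 0.

Lemma fourier_le w s : Z w s <= Z w 0.
Proof.
have bE : bounded_measurable (fun t => expR (energy chi w t)).
  exact/bm_exp/bm_energy.
have b s' : bounded_measurable (fun t => cos (phase t s') * expR (energy chi w t)).
  apply: bmM => //.
  by under eq_fun do rewrite -[phase _ _]addr0; exact: bm_cos_phase.
apply: le_Rintegral => //; [exact: bm_integrable|exact: bm_integrable|move=> t _].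
rewrite ler_wpM2r ?expR_ge0// (_ : phase t 0 = 0) ?cos0 ?cos_le1//.
by rewrite /phase big1// => v _; rewrite ffunE mul0r.
Qed.

Lemma corr_ge0 w s : (forall i, 0 <= w i) -> 0 <= corr w s.
Proof. by move=> w0; rewrite divr_ge0// fourier_ge0. Qed.

Lemma corr0 w : (forall i, 0 <= w i) -> corr w 0 = 1.
Proof. by move=> w0; rewrite /corr divff// gt_eqF// fourier0_gt0. Qed.

Lemma hop0_le w w1 : (forall i, 0 <= w1 i) ->
  hop chi w1 (Z w) 0 <= (\sum_i w1 i) * Z w 0.
Proof.
move=> w10; rewrite /hop mulr_suml; apply: ler_sum => i _.
rewrite -mulrA ler_wpM2l// mulrC ler_pdivrMr//.
by rewrite mulr_natr mulr2n lerD// fourier_le.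
Qed.

Lemma hop_ginibre w w1 s : (forall i, 0 <= w i) -> (forall i, 0 <= w1 i) ->
  hop chi w1 (Z w) 0 * Z w s <= hop chi w1 (Z w) s * Z w 0.
Proof.
move=> w0 w10; rewrite /hop !mulr_suml; apply: ler_sum => i _.
rewrite -!mulrA ler_wpM2l ?divr_ge0// ?ler_wpM2l ?invr_ge0//.
by have := ginibre chi s (chi i) w0; rewrite add0r sub0r fourierN; lra.
Qed.

Lemma hop2E w1 (X : charge -> R) s : hop chi w1 (hop chi w1 X) s =
  \sum_i \sum_j w1 i / 2 * (w1 j / 2) *
   ((X (s + (chi i + chi j)) + X (s - (chi i + chi j))) +
    (X (s + (chi i - chi j)) + X (s - (chi i - chi j)))).
Proof.
rewrite {1}/hop; apply: eq_bigr => i _; rewrite /hop -big_split mulr_sumr.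
apply: eq_bigr => j _ /=; rewrite opprD opprB !addrA.
rewrite (addrAC s (chi j)) -mulrDr mulrA; congr (_ * _).
by rewrite addrCA addrA addrA; ring.
Qed.

(** The square of the energy is a nonnegative combination of cosines, of charges
    chi i + chi j and chi i - chi j. *)
Lemma hop2_ginibre w w1 s : (forall i, 0 <= w i) -> (forall i, 0 <= w1 i) ->
  hop chi w1 (hop chi w1 (Z w)) 0 * Z w s <=
  hop chi w1 (hop chi w1 (Z w)) s * Z w 0.
Proof.
move=> w0 w10; rewrite !hop2E !mulr_suml; apply: ler_sum => i _.
rewrite !mulr_suml; apply: ler_sum => j _.
rewrite -!mulrA ler_wpM2l ?divr_ge0// ?ler_wpM2l ?invr_ge0//.
have gin m : (Z w m + Z w m) * Z w s <= (Z w (s + m) + Z w (s - m)) * Z w 0.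
  by have := ginibre chi s m w0; lra.
by rewrite !add0r !fourierN [leLHS]mulrDl [leRHS]mulrDl lerD.
Qed.

Section interpolation.
Variables (w0 w1 : I -> R).
Local Notation wh h := (fun i => w0 i + h * w1 i).

(** The Gibbs mean of cos(s . theta) C, where C is the energy of w1; [response2] is
    that of cos(s . theta) C^2. *)
Definition response s (h : R) : R := hop chi w1 (Z (wh h)) s / Z (wh h) 0.
Definition response2 s (h : R) : R :=
  hop chi w1 (hop chi w1 (Z (wh h))) s / Z (wh h) 0.

Lemma is_derive_ratio (X : R -> R) (dX : R) (h : R) : Z (wh h) 0 != 0 ->
  is_derive h (1 : R) X dX ->
  is_derive h (1 : R) (fun h => X h / Z (wh h) 0)
    (dX / Z (wh h) 0 - X h / Z (wh h) 0 * response 0 h).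
Proof.
move=> Z0 dXh; have dZ := is_derive_fourier chi w0 w1 0 h.
have dV := is_deriveV Z0 dZ.
have := is_deriveM dXh dV.
rewrite /response /GRing.scale/= => H; apply: is_derive_eq.
by field.
Qed.

Lemma is_derive_hop s (h : R) :
  is_derive h (1 : R) (fun h => hop chi w1 (Z (wh h)) s)
    (hop chi w1 (hop chi w1 (Z (wh h))) s).
Proof.
apply: is_derive_bigsum => i.
have := is_derive_fourier chi w0 w1 (s + chi i) h.
have := is_derive_fourier chi w0 w1 (s - chi i) h.
move=> d1 d2; apply: is_derive_eq; rewrite /GRing.scale/=; ring.
Qed.

Lemma is_derive_corr s (h : R) : Z (wh h) 0 != 0 ->
  is_derive h (1 : R) (fun h => corr (wh h) s)
    (response s h - corr (wh h) s * response 0 h).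
Proof.
by move=> Z0; exact: is_derive_ratio (is_derive_fourier chi w0 w1 s h).
Qed.

Lemma is_derive_response s (h : R) : Z (wh h) 0 != 0 ->
  is_derive h (1 : R) (response s)
    (response2 s h - response s h * response 0 h).
Proof. by move=> Z0; exact: is_derive_ratio (is_derive_hop s h). Qed.

(** The derivative of the correlation is the truncated correlation with C. *)
Lemma response_ginibre s h : (forall i, 0 <= wh h i) -> (forall i, 0 <= w1 i) ->
  0 <= response s h - corr (wh h) s * response 0 h.
Proof.
move=> wh0 w10; have Z0 := fourier0_gt0 chi wh0.
rewrite /response /corr subr_ge0 ler_pdivlMr// [leLHS](_ : _ = 
  hop chi w1 (Z (wh h)) 0 * Z (wh h) s / Z (wh h) 0); last by field; rewrite gt_eqF.
by rewrite ler_pdivrMr// hop_ginibre.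
Qed.

Lemma response2_ginibre s h : (forall i, 0 <= wh h i) -> (forall i, 0 <= w1 i) ->
  0 <= response2 s h - corr (wh h) s * response2 0 h.
Proof.
move=> wh0 w10; have Z0 := fourier0_gt0 chi wh0.
rewrite /response2 /corr subr_ge0 ler_pdivlMr// [leLHS](_ : _ = 
  hop chi w1 (hop chi w1 (Z (wh h))) 0 * Z (wh h) s / Z (wh h) 0); last by field; rewrite gt_eqF.
by rewrite ler_pdivrMr// hop2_ginibre.
Qed.

Lemma response0_le h : (forall i, 0 <= wh h i) -> (forall i, 0 <= w1 i) ->
  response 0 h <= \sum_i w1 i.
Proof.
move=> wh0 w10; have Z0 := fourier0_gt0 chi wh0.
by rewrite /response ler_pdivrMr// hop0_le.
Qed.

(** With g the correlation, g'' + 2 kappa g' is the truncated correlation with C^2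
    plus 2 (kappa - <C>) g', hence nonnegative: g is convex in
    1 - exp(-2 kappa h), so the slope of its chord from 0 to t is at most its slope at t. *)
Lemma corr_chord s (kappa t : R) :
  (forall i, 0 <= w0 i) -> (forall i, 0 <= w1 i) ->
  \sum_i w1 i <= kappa -> 0 <= t ->
  2 * kappa * (corr (wh t) s - corr w0 s) <=
  (expR (2 * kappa * t) - 1) * (response s t - corr (wh t) s * response 0 t).
Proof.
move=> w00 w10 wk t0.
have k0 : 0 <= kappa by apply: le_trans wk; apply: sumr_ge0.
have wh0 h : 0 <= h -> forall i, 0 <= wh h i.
  by move=> h0 i; rewrite addr_ge0// mulr_ge0.
have Zn0 h : 0 <= h -> Z (wh h) 0 != 0.
  by move=> h0; rewrite gt_eqF// fourier0_gt0//; exact: wh0.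
pose g h := corr (wh h) s.
pose dg h := response s h - g h * response 0 h.
(* K increases because its derivative is (exp(2 kappa h) - 1) (g'' + 2 kappa g'). *)
pose K h := (expR (2 * kappa * h) - 1) * dg h - 2 * kappa * g h.
pose ddg h := (response2 s h - g h * response2 0 h) - 2 * response 0 h * dg h.
pose dK h := (expR (2 * kappa * h) - 1) * (ddg h + 2 * kappa * dg h).
have DK h : 0 <= h <= t -> is_derive h (1 : R) K (dK h).
  move=> /andP[h0 _].
  have d1 : is_derive h (1 : R) g (dg h) by apply: is_derive_corr; exact: Zn0.
  have d2 := is_derive_response s (Zn0 h h0).
  have d3 := is_derive_response 0 (Zn0 h h0).
  rewrite /K /dg; apply: is_derive_eq.
  by rewrite /GRing.scale/= /dK /ddg /dg; ring.
have K0 : forall h, 0 <= h <= t -> 0 <= dK h.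
  move=> h /andP[h0 _]; apply: mulr_ge0.
    rewrite subr_ge0; apply: le_trans (expR_ge1Dx _).
    by rewrite lerDl !mulr_ge0.
  have dg0 : 0 <= dg h by apply: response_ginibre => //; exact: wh0.
  have d2 : 0 <= response2 s h - g h * response2 0 h.
    by apply: response2_ginibre => //; exact: wh0.
  have rk : response 0 h <= kappa.
    by apply: le_trans wk; apply: response0_le => //; exact: wh0.
  rewrite /ddg -addrA addr_ge0// -mulNr -mulrDl mulr_ge0//; lra.
have := le_of_is_derive t0 DK K0.
rewrite /K mulr0 expR0 subrr mul0r sub0r.
have w00E : (fun i => w0 i + 0 * w1 i) = w0.
  by apply/funext => i; rewrite mul0r addr0.
have -> : g 0 = corr w0 s by rewrite /g w00E.
rewrite -/(g t) -/(dg t); lra.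
Qed.

End interpolation.

Lemma corr_mono w w' s : (forall i, 0 <= w i) -> (forall i, w i <= w' i) ->
  corr w s <= corr w' s.
Proof.
(* Interpolate linearly between w and w'. *)
move=> w0 ww'; pose w1 i := w' i - w i.
have w10 i : 0 <= w1 i by rewrite subr_ge0.
have wh0 h : 0 <= h -> forall i, 0 <= w i + h * w1 i.
  by move=> h0 i; rewrite addr_ge0// mulr_ge0.
have -> : w' = (fun i => w i + 1 * w1 i).
  by apply/funext => i; rewrite mul1r addrC subrK.
have {1}-> : w = (fun i => w i + 0 * w1 i).
  by apply/funext => i; rewrite mul0r addr0.
apply: (le_of_is_derive (f := fun h => corr (fun i => w i + h * w1 i) s) (df := fun h =>
  response w w1 s h - corr (fun i => w i + h * w1 i) s * response w w1 0 h)) => // h /andP[h0 _].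
  by apply: is_derive_corr; rewrite gt_eqF// fourier0_gt0//; exact: wh0.
by apply: response_ginibre => //; exact: wh0.
Qed.

End correlations.

(** * Change of the vertex set *)

Section embedding.
Variables (R : realType) (U V : finType) (phi : U -> V).
Hypothesis phi_inj : injective phi.
Variables (wU : U * U -> R) (wV : V * V -> R).
Hypothesis wVE : forall u u', wV (phi u, phi u') = wU (u, u').
Hypothesis wV0 : forall e, e.1 \notin codom phi \/ e.2 \notin codom phi -> wV e = 0.

Let lifts (s : {ffun U -> int}) (s' : {ffun V -> int}) :=
  (forall u, s' (phi u) = s u) /\ (forall v, v \notin codom phi -> s' v = 0).

Let lifts_unit u : lifts (unit_charge u) (unit_charge (phi u)).
Proof.
split=> [u'|v vphi]; rewrite !ffunE ?(inj_eq phi_inj)//.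
have vu : v != phi u by apply: contraNneq vphi => ->; exact: codom_f.
by rewrite (negPf vu).
Qed.

Let liftsD s1 s1' s2 s2' : lifts s1 s1' -> lifts s2 s2' -> lifts (s1 + s2) (s1' + s2').
Proof.
move=> [a1 b1] [a2 b2]; split=> [u|v vphi].
  by rewrite [LHS]ffunE [RHS]ffunE a1 a2.
by rewrite [LHS]ffunE b1// b2.
Qed.

Let liftsN s1 s1' : lifts s1 s1' -> lifts (- s1) (- s1').
Proof.
move=> [a1 b1]; split=> [u|v vphi].
  by rewrite [LHS]ffunE [RHS]ffunE a1.
by rewrite [LHS]ffunE b1// oppr0.
Qed.

Let lifts_moment k s s' : lifts s s' ->
  free_moment (@dipole V) wV k s' = free_moment (@dipole U) wU k s.
Proof.
elim: k s s' => [|k ih] s s' ss'; rewrite /free_moment /=.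
  congr (nat_of_bool _)%:R; case: ss' => a b; apply/eqP/eqP => s0.
    by apply/ffunP => u; rewrite -a s0 !ffunE.
  apply/ffunP => v; have [/codomP[u ->]|vphi] := boolP (v \in codom phi).
    by rewrite a s0 !ffunE.
  by rewrite b// ffunE.
pose f (e : U * U) := (phi e.1, phi e.2).
have finj : injective f by move=> [a b] [a' b'] [/phi_inj -> /phi_inj ->].
rewrite {1}/hop (bigID (mem [set f e | e : U * U]))/= [X in _ + X]big1 ?addr0.
  rewrite big_imset/=; last by move=> x y _ _; exact: finj.
  apply: eq_bigr => -[u u'] _; rewrite /f/= wVE.
  have lf : lifts (dipole (u, u')) (dipole (phi u, phi u')).
    by apply: liftsD; [exact: lifts_unit | apply: liftsN; exact: lifts_unit].
  congr (_ * (_ + _)); apply: ih; apply: liftsD => //; exact: liftsN.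
move=> e ef; rewrite wV0 ?mul0r//; move: ef.
have [/codomP[u e1]|] := boolP (e.1 \in codom phi); last by left.
have [/codomP[u' e2]|] := boolP (e.2 \in codom phi); last by right.
move/negP; case; apply/imsetP; exists (u, u') => //.
by rewrite /f -e1 -e2; case: e {e1 e2}.
Qed.

(** Moments of the energy are counted by charges alone, and charges carried by the
    image of phi stay there under hopping. *)
Lemma corr_embedding u u' :
  corr (@dipole V) wV (unit_charge (phi u) - unit_charge (phi u')) =
  corr (@dipole U) wU (unit_charge u - unit_charge u').
Proof.
have E s s' : lifts s s' -> fourier (@dipole V) wV s' = fourier (@dipole U) wU s.
  move=> ss'; have c1 := @cvg_free_moment _ _ _ (@dipole V) wV s'.
  have c2 := @cvg_free_moment _ _ _ (@dipole U) wU s.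
  rewrite -(cvg_lim (@Rhausdorff R) c1) -(cvg_lim (@Rhausdorff R) c2).
  congr (lim (_ @ \oo)); apply/funext => n; apply: eq_bigr => k _.
  by rewrite (lifts_moment k ss').
rewrite /corr (E (unit_charge u - unit_charge u')) ?(E 0)//.
  by split=> [u1|v]; rewrite !ffunE.
by apply: liftsD; [exact: lifts_unit | apply: liftsN; exact: lifts_unit].
Qed.

End embedding.

(** * Bernoulli expectations and their density derivative *)

Section bernoulli.
Variables (R : realType) (T : finType).
Implicit Types (A S : {set T}) (F : {set T} -> R) (q : R).

Definition bernoulli_weight q A S : R := \prod_(i in A) (if i \in S then q else 1 - q).

Lemma bernoulli_expectE q A F :
  bernoulli_expect q A F = \sum_(S in powerset A) bernoulli_weight q A S * F S.
Proof. by []. Qed.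

Lemma bernoulli_weight_ge0 q A S : 0 <= q <= 1 -> 0 <= bernoulli_weight q A S.
Proof.
move=> /andP[q0 q1]; apply: prodr_ge0 => i _.
by case: ifP => // _; rewrite subr_ge0.
Qed.

Lemma bernoulli_expect_le q A F G : 0 <= q <= 1 ->
  (forall S, S \subset A -> F S <= G S) ->
  bernoulli_expect q A F <= bernoulli_expect q A G.
Proof.
move=> q01 FG; apply: ler_sum => S; rewrite powersetE => SA.
by rewrite ler_wpM2l ?FG//; exact: bernoulli_weight_ge0.
Qed.

(** Conditioning on the variable i. *)
Lemma powerset_split A i (G : {set T} -> R) : i \in A ->
  \sum_(S in powerset A) G S =
  \sum_(S in powerset (A :\ i)) (G (i |: S) + G S).
Proof.
move=> iA; rewrite (bigID (fun S : {set T} => i \in S))/= big_split/=; congr (_ + _).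
  rewrite (reindex_onto (fun S => i |: S) (fun S => S :\ i))/=; last first.
    by move=> S /andP[_ iS]; rewrite finset.setD1K.
  apply: eq_bigl => S; rewrite !powersetE finset.setU11 andbT finset.subsetD1.
  rewrite finset.subUset finset.sub1set iA /=.
  have [iS|iS] := boolP (i \in S); last by rewrite finset.setU1K// eqxx.
  rewrite andbF; apply/negbTE/negP => /andP[_ /eqP e].
  by move: iS; rewrite -e !inE eqxx.
by apply: eq_bigl => S; rewrite !powersetE finset.subsetD1.
Qed.

Lemma bernoulli_weightU q A S i : i \in A ->
  bernoulli_weight q A (i |: S) = q * bernoulli_weight q (A :\ i) S.
Proof.
move=> iA; rewrite /bernoulli_weight (big_setD1 i)//= finset.setU11; congr (_ * _).
by apply: eq_bigr => j; rewrite !inE => /andP[/negPf ->].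
Qed.

Lemma bernoulli_weightD q A S i : i \in A -> i \notin S ->
  bernoulli_weight q A S = (1 - q) * bernoulli_weight q (A :\ i) S.
Proof.
by move=> iA iS; rewrite /bernoulli_weight (big_setD1 i)//= (negPf iS).
Qed.

Lemma bernoulli_expect_split q A F i : i \in A ->
  bernoulli_expect q A F =
  bernoulli_expect q (A :\ i) (fun S => q * F (i |: S) + (1 - q) * F S).
Proof.
move=> iA; rewrite !bernoulli_expectE (powerset_split _ iA).
apply: eq_bigr => S; rewrite powersetE finset.subsetD1 => /andP[_ iS].
rewrite bernoulli_weightU// (bernoulli_weightD _ iA iS); ring.
Qed.

Lemma bernoulli_expect_cst q A (c : R) : bernoulli_expect q A (fun=> c) = c.
Proof.
have [n] := ubnP #|A|; elim: n A => // n ih A.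
have [->|[i iA]] := finset.set_0Vmem A.
  rewrite bernoulli_expectE powerset0 big_set1 /bernoulli_weight big_set0 mul1r//.
rewrite (cardsD1 i) iA ltnS => An; rewrite (bernoulli_expect_split _ _ iA).
rewrite (_ : (fun=> _) = (fun=> c)) ?ih//.
by apply/funext => S; ring.
Qed.

Lemma bernoulli_expect1 A F : bernoulli_expect 1 A F = F A.
Proof.
rewrite bernoulli_expectE (bigD1 A) ?powersetE//= big1 ?addr0 => [|S].
  by rewrite /bernoulli_weight big1 ?mul1r// => i ->.
rewrite powersetE => /andP[SA SneA].
have /fintype.subsetPn[i iA iS] : ~~ (A \subset S).
  by apply: contra SneA => AS; rewrite finset.eqEsubset SA.
by rewrite /bernoulli_weight (bigD1 i)//= (negPf iS) subrr !mul0r.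
Qed.

Lemma is_derive_bigprod (r : seq T) (f : T -> R -> R) (df : T -> R) (x : R) :
  uniq r -> (forall i, is_derive x (1 : R) (f i) (df i)) ->
  is_derive x (1 : R) (fun y => \prod_(i <- r) f i y)
    (\sum_(i <- r) df i * \prod_(j <- r | j != i) f j x).
Proof.
move=> + fD; elim: r => [_|i r ih /= /andP[ir ur]].
  rewrite big_nil; under eq_fun do rewrite big_nil; exact: is_derive_cst.
under eq_fun do rewrite big_cons.
have D := is_deriveM (fD i) (ih ur); apply: is_derive_eq.
rewrite /GRing.scale/= big_cons big_cons eqxx/= addrC mulrC; congr (_ + _).
  congr (_ * _); rewrite big_seq_cond [RHS]big_seq_cond.
  by apply: eq_bigl => j; rewrite andbT; case: (boolP (j \in r)) => //= jr;
    apply/esym; apply: contraNneq ir => <-.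
rewrite mulr_sumr big_seq [RHS]big_seq; apply: eq_bigr => k kr.
rewrite big_cons ifT; last by apply: contraNneq ir => ->.
by rewrite mulrCA.
Qed.

Lemma is_derive_bernoulli_weight A S q :
  is_derive q (1 : R) (fun q => bernoulli_weight q A S)
    (\sum_(i in A) (if i \in S then 1 else - 1) * bernoulli_weight q (A :\ i) S).
Proof.
have fD i : is_derive q (1 : R) (fun q : R => if i \in S then q else 1 - q)
    (if i \in S then 1 else - 1).
  case: ifP => _; first exact: is_derive_id.
  by apply: is_derive_eq; ring.
have := is_derive_bigprod (enum_uniq A) fD.
rewrite /bernoulli_weight; under [in X in X -> _]eq_fun do rewrite big_enum/=.
rewrite big_enum/=; congr is_derive; apply: eq_bigr => i _; congr (_ * _).
by rewrite big_enum_cond/=; apply: eq_bigl => j; rewrite !inE andbC.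
Qed.

(** Russo's formula: the density derivative of an expectation is the sum over the
    variables of the mean effect of switching one of them on. *)
Lemma russo q A F :
  \sum_(S in powerset A) (\sum_(i in A) (if i \in S then 1 else - 1) *
     bernoulli_weight q (A :\ i) S) * F S =
  \sum_(i in A) bernoulli_expect q (A :\ i) (fun S => F (i |: S) - F S).
Proof.
under eq_bigr do rewrite mulr_suml.
rewrite exchange_big; apply: eq_bigr => i iA /=; rewrite (powerset_split _ iA).
apply: eq_bigr => S; rewrite powersetE finset.subsetD1 => /andP[_ iS].
rewrite finset.setU11 (negPf iS) -!/(bernoulli_weight _ _ _) mulN1r mul1r mulrBr mulNr; congr (_ * _ - _).
by apply: eq_bigr => j; rewrite !inE => /andP[/negPf ->].
Qed.

End bernoulli.

(** * Comparison of diluted and clean models *)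

Section dilution_path.
Variables (R : realType) (V T : finType) (A : {set T}).
Variables (tau : V * V -> {set T}) (w : V * V -> R) (alpha : nat) (kappa : R).
Notation charge := {ffun V -> int}.
Hypothesis w_ge0 : forall e, 0 <= w e.
Hypothesis alpha_gt0 : (0 < alpha)%N.
Hypothesis kappa_gt0 : 0 < kappa.
Hypothesis tauP : forall e, w e != 0 -> tau e \subset A /\ #|tau e| = alpha.
Hypothesis w_kappa : forall i, i \in A -> \sum_(e | i \in tau e) w e <= kappa.
Variable s : charge.

Local Notation Z := (fourier (@dipole V)).
Local Notation corr := (corr (@dipole V)).
Local Notation H := (H_fun kappa).

(** An edge e is open in S when all the variables tau e that control it belong to S. *)
Definition open_weight (S : {set T}) e : R := w e * (tau e \subset S)%:R.

(** The truncated correlation of cos(s . theta) with the energy of w1, in the Gibbs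
    measure of weights v. *)
Definition covariance_with (v w1 : V * V -> R) : R :=
  hop (@dipole V) w1 (Z v) s / Z v 0 - corr v s * (hop (@dipole V) w1 (Z v) 0 / Z v 0).

Lemma covariance_with0 v w1 : (forall e, w1 e = 0) -> covariance_with v w1 = 0.
Proof.
move=> w10; rewrite /covariance_with /hop.
by rewrite !big1 ?mul0r ?mulr0 ?subrr// => e _; rewrite w10 !mul0r.
Qed.

Lemma covariance_with_sum (J : finType) (P : pred J) v (w1 : J -> V * V -> R) :
  covariance_with v (fun e => \sum_(j | P j) w1 j e) =
  \sum_(j | P j) covariance_with v (w1 j).
Proof.
rewrite /covariance_with /hop sumrB -mulr_sumr -!mulr_suml.
congr (_ / _ - _ * (_ / _)); rewrite exchange_big; apply: eq_bigr => e _ /=.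
  by rewrite !mulr_suml.
by rewrite !mulr_suml.
Qed.

Lemma covariance_withZ v (c : R) w1 :
  covariance_with v (fun e => c * w1 e) = c * covariance_with v w1.
Proof.
have E s' : hop (@dipole V) (fun e => c * w1 e) (Z v) s' = c * hop (@dipole V) w1 (Z v) s'.
  by rewrite /hop mulr_sumr; apply: eq_bigr => e _; rewrite !mulrA.
by rewrite /covariance_with !E; ring.
Qed.

Definition scaled (t : R) (S : {set T}) e : R := t * open_weight S e.
Definition edges_at i (S : {set T}) e : R := (i \in tau e)%:R * open_weight S e.

Lemma open_weight_ge0 S e : 0 <= open_weight S e.
Proof. by rewrite mulr_ge0. Qed.

(** Every edge is counted once for each of the alpha variables that control it. *)
Lemma covariance_toggles v S :
  alpha%:R * covariance_with v (open_weight S) =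
  \sum_(i in A) covariance_with v (edges_at i S).
Proof.
rewrite -covariance_with_sum -covariance_withZ.
congr covariance_with; apply/funext => e; rewrite -mulr_suml.
have [we|/tauP[tA ta]] := eqVneq (w e) 0; first by rewrite /open_weight we mul0r !mulr0.
congr (_ * _); rewrite -natr_sum -ta -sum1_card; congr _%:R.
rewrite [RHS](big_setID (tau e))/= (finset.setIidPr tA) [X in (_ + X)%N]big1 => [|i].
  by rewrite addn0; apply: eq_bigr => i ->.
by rewrite !inE => /andP[/negPf ->].
Qed.

(** Switching on the variable i scales from 0 to t the edges it controls that are
    otherwise open; [corr_chord] bounds the effect. *)
Lemma chord_toggle (t : R) i (S : {set T}) : 0 <= t -> i \in A -> i \notin S ->
  2 * kappa * (corr (scaled t (i |: S)) s - corr (scaled t S) s) <=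
  (expR (2 * kappa * t) - 1) *
    covariance_with (scaled t (i |: S)) (edges_at i (i |: S)).
Proof.
move=> t0 iA iS.
have E : scaled t (i |: S) = (fun e => scaled t S e + t * edges_at i (i |: S) e).
  apply/funext => e; rewrite /scaled /edges_at /open_weight -mulrDr; congr (_ * _).
  rewrite mulrCA -mulrDr; congr (_ * _).
  have [ie|ie] := boolP (i \in tau e); rewrite ?mul1r ?mul0r ?addr0.
    rewrite (_ : tau e \subset S = false) ?add0r//.
    by apply/negP => /fintype.subsetP/(_ _ ie); rewrite (negPf iS).
  congr (nat_of_bool _)%:R; apply/idP/idP => [/fintype.subsetP sub|/fintype.subset_trans]; last by apply; exact: finset.subsetUr.
  apply/fintype.subsetP => j je; move: (sub _ je); rewrite !inE => /orP[/eqP ji|//].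
  by move: ie; rewrite -ji je.
rewrite E; apply: corr_chord => //.
- by move=> e; rewrite mulr_ge0// open_weight_ge0.
- by move=> e; rewrite mulr_ge0// open_weight_ge0.
apply: le_trans (w_kappa iA); rewrite [leRHS]big_mkcond; apply: ler_sum => e _.
rewrite /edges_at /open_weight; case: (i \in tau e); rewrite ?mul0r// mul1r.
by rewrite ler_piMr// lern1 leq_b1.
Qed.

(** The solution q of q^alpha H(t) = c. *)
Definition path_density (c t : R) : R := expR ((ln c - ln (H t)) / alpha%:R).

Lemma H_fun_gt0 (t : R) : 0 < t -> 0 < H t.
Proof.
by move=> t0; rewrite subr_gt0 expR_lt1 mulNr -mulNr !nmulr_rlt0// oppr_lt0.
Qed.

Definition annealed (c t : R) : R :=
  bernoulli_expect (path_density c t) A (fun S => corr (scaled t S) s).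

(** The derivative of [annealed], grouped by variable: the term of i is the
    derivative of the correlation in the scale of the edges at i, minus the effect
    of i that comes from the decrease of the density. *)
Definition dannealed (c t : R) : R :=
  path_density c t / alpha%:R * \sum_(i in A) bernoulli_expect (path_density c t) (A :\ i)
   (fun S => covariance_with (scaled t (i |: S)) (edges_at i (i |: S)) -
     2 * kappa / (expR (2 * kappa * t) - 1) *
       (corr (scaled t (i |: S)) s - corr (scaled t S) s)).

Lemma is_derive_annealed (c t : R) : 0 < t ->
  is_derive t (1 : R) (annealed c) (dannealed c t).
Proof.
move=> t0; have Ht := H_fun_gt0 t0.
have a0 : alpha%:R != 0 :> R by rewrite pnatr_eq0 -lt0n.
have E0 : expR (2 * kappa * t) - 1 != 0.
  by rewrite gt_eqF// subr_gt0 expR_gt1 !mulr_gt0.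
set q := path_density c t.
pose dq := - (2 * kappa / (expR (2 * kappa * t) - 1)) * (q / alpha%:R).
have dH : is_derive t (1 : R) H (2 * kappa * expR (- 2 * kappa * t)).
  by rewrite /H_fun; apply: is_derive_eq; rewrite /GRing.scale/=; ring.
have Dq : is_derive t (1 : R) (path_density c) dq.
  have dl := is_derive1_ln Ht.
  have dlH := is_derive1_comp dl dH.
  rewrite /path_density; apply: is_derive_eq.
  rewrite /GRing.scale/= /dq /q /path_density.
  have -> : H t = (expR (2 * kappa * t) - 1) / expR (2 * kappa * t).
    by rewrite mulrBl divff ?expR_eq0// /H_fun div1r -expRN !mulNr.
  rewrite !mulNr expRN; field.
  by rewrite a0 E0 expR_eq0.
have Dg S : is_derive t (1 : R) (fun t => corr (scaled t S) s)
    (covariance_with (scaled t S) (open_weight S)).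
  have EE : scaled^~ S = (fun t e => 0 + t * open_weight S e).
    by apply/funext => u; apply/funext => e; rewrite add0r.
  have -> : scaled t S = (fun e => 0 + t * open_weight S e) by exact: (congr1 (fun f => f t) EE).
  rewrite (_ : (fun t => _) = (fun t => corr (fun e => 0 + t * open_weight S e) s)); last first.
    by apply/funext => u; rewrite -[scaled u S]/((scaled^~ S) u) EE.
  apply: is_derive_corr; rewrite gt_eqF// fourier0_gt0// => e.
  by rewrite add0r mulr_ge0 ?open_weight_ge0// ltW.
have Dw S : is_derive t (1 : R) (fun t => bernoulli_weight (path_density c t) A S)
   ((\sum_(i in A) (if i \in S then 1 else - 1) * bernoulli_weight q (A :\ i) S) * dq).
  have := is_derive1_comp (is_derive_bernoulli_weight A S q) Dq.
  by rewrite mulrC.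
have D : is_derive t (1 : R) (annealed c) (\sum_(S in powerset A)
   (bernoulli_weight q A S * covariance_with (scaled t S) (open_weight S) +
    (\sum_(i in A) (if i \in S then 1 else - 1) * bernoulli_weight q (A :\ i) S) * dq *
     corr (scaled t S) s)).
  apply: is_derive_bigsum => S; have := is_deriveM (Dw S) (Dg S).
  by rewrite /GRing.scale/= [X in _ + X]mulrC.
apply: is_derive_eq; rewrite big_split/= /dannealed -/q.
under [X in _ + X = _]eq_bigr do rewrite mulrAC.
rewrite -mulr_suml russo.
have -> : \sum_(S in powerset A) bernoulli_weight q A S *
    covariance_with (scaled t S) (open_weight S) =
  q / alpha%:R * \sum_(i in A) bernoulli_expect q (A :\ i)
   (fun S => covariance_with (scaled t (i |: S)) (edges_at i (i |: S))).
  apply: (mulfI a0); rewrite mulr_sumr.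
  under eq_bigr do rewrite mulrCA covariance_toggles mulr_sumr.
  rewrite exchange_big/= mulrA mulrCA divff// mulr1 mulr_sumr.
  apply: eq_bigr => i iA; rewrite (powerset_split _ iA) bernoulli_expectE mulr_sumr.
  apply: eq_bigr => S; rewrite powersetE finset.subsetD1 => /andP[_ iS].
  have c0 : covariance_with (scaled t S) (edges_at i S) = 0.
    apply: covariance_with0 => e; rewrite /edges_at /open_weight.
    have [ie|] := boolP (i \in tau e); last by rewrite mul0r.
    rewrite (_ : tau e \subset S = false) ?mulr0//.
    by apply/negP => /fintype.subsetP/(_ _ ie); rewrite (negPf iS).
  by rewrite c0 mulr0 addr0 (bernoulli_weightU _ _ iA) -mulrA.
rewrite [in RHS](eq_bigr (fun i => bernoulli_expect q (A :\ i)
    (fun S => covariance_with (scaled t (i |: S)) (edges_at i (i |: S))) -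
  2 * kappa / (expR (2 * kappa * t) - 1) * bernoulli_expect q (A :\ i)
    (fun S => corr (scaled t (i |: S)) s - corr (scaled t S) s))); last first.
  move=> i _; rewrite !bernoulli_expectE mulr_sumr -sumrB; apply: eq_bigr => S _.
  by rewrite [LHS]mulrBr [X in _ - X]mulrCA.
rewrite sumrB -mulr_sumr /dq.
set X := \sum_(i in A) _; set Y := \sum_(i in A) _; ring.
Qed.

Lemma dannealed_ge0 (c t : R) : 0 < t -> path_density c t <= 1 ->
  0 <= dannealed c t.
Proof.
move=> t0 q1; have q0 : 0 <= path_density c t by exact: expR_ge0.
apply: mulr_ge0; first by rewrite divr_ge0.
apply: sumr_ge0 => i iA.
rewrite -[leLHS](bernoulli_expect_cst (path_density c t) (A :\ i) 0).
apply: bernoulli_expect_le => [|S]; first by rewrite q0.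
rewrite finset.subsetD1 => /andP[_ iS].
have E0 : 0 < expR (2 * kappa * t) - 1.
  by rewrite subr_gt0 expR_gt1 !mulr_gt0.
rewrite subr_ge0 mulrAC ler_pdivrMr// [leRHS]mulrC.
by apply: chord_toggle => //; exact: ltW.
Qed.

(** Move along q^alpha H(t) = c with c = p^alpha H(beta), from density 1 at the
    coupling t1 with H(t1) = c to density p at coupling beta.  The annealed
    correlation is nondecreasing on the way, and t1 is at least b. *)
Lemma dilution_comparison (p beta b : R) : 0 < p <= 1 -> 0 <= beta -> 0 <= b ->
  H b <= p ^+ alpha * H beta ->
  corr (fun e => b * w e) s <=
  bernoulli_expect p A (fun S => corr (scaled beta S) s).
Proof.
move=> /andP[p0 p1] beta0 b0 Hb.
have clean t : scaled t A = (fun e => t * w e).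
  apply/funext => e; rewrite /scaled /open_weight.
  have [->|/tauP[-> _]] := eqVneq (w e) 0; by rewrite ?mul0r ?mulr1.
set c := p ^+ alpha * H beta in Hb.
have H0 t : 0 <= t -> 0 <= H t.
  rewrite le_eqVlt => /predU1P[<-|/H_fun_gt0/ltW//].
  by rewrite /H_fun mulr0 expR0 subrr.
have c_ge0 : 0 <= c by rewrite mulr_ge0 ?exprn_ge0 ?H0// ltW.
have k2 : 0 < 2 * kappa by rewrite mulr_gt0.
move: c_ge0; rewrite le_eqVlt => /predU1P[c0|c0].
  have z t : 0 <= t -> H t <= 0 -> t = 0.
    move=> t0 Ht; apply/eqP; rewrite eq_le t0 andbT leNgt.
    by apply/negP => /H_fun_gt0; rewrite ltNge Ht.
  have -> : b = 0 by apply: z => //; rewrite c0.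
  have -> : beta = 0.
    apply: z => //; rewrite -(pmulr_rle0 _ (exprn_gt0 alpha p0)) -/c -c0//.
  have -> : (fun S => corr (scaled 0 S) s) = (fun=> corr (fun e => 0 * w e) s).
    apply/funext => S; have -> // : scaled 0 S = (fun e => 0 * w e).
    by apply/funext => e; rewrite /scaled !mul0r.
  by rewrite bernoulli_expect_cst.
have cH : c <= H beta.
  by rewrite ler_piMl ?H0// exprn_ile1// ltW.
have c1 : c < 1 by rewrite (le_lt_trans cH)// ltrBlDr ltrDl expR_gt0.
pose t1 := - ln (1 - c) / (2 * kappa).
have c1' : 0 < 1 - c by rewrite subr_gt0.
have Ht1 : H t1 = c.
  rewrite /H_fun /t1.
  have -> : - 2 * kappa * (- ln (1 - c) / (2 * kappa)) = ln (1 - c).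
    by field; rewrite gt_eqF.
  by rewrite lnK ?posrE//; ring.
have t10 : 0 < t1.
  by rewrite divr_gt0// oppr_gt0 ln_lt0// c1' /= ltrBlDr ltrDl.
have lnH t u : H t <= u -> u < 1 -> 2 * kappa * t <= - ln (1 - u).
  move=> Hu u1; rewrite lerNr -[leRHS]expRK ler_ln ?posrE ?expR_gt0 ?subr_gt0//.
  move: Hu; rewrite /H_fun !mulNr; lra.
have bt1 : b <= t1 by rewrite ler_pdivlMr// mulrC lnH.
have t1b : t1 <= beta.
  rewrite ler_pdivrMr// lerNl -[leLHS]expRK ler_ln ?posrE ?expR_gt0//.
  by move: cH; rewrite /H_fun mulNr [beta * _]mulrC !mulNr; lra.
apply: (@le_trans _ _ (corr (fun e => t1 * w e) s)).
  by apply: corr_mono => e; [rewrite mulr_ge0 | rewrite ler_wpM2r].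
have pd1 : path_density c t1 = 1 by rewrite /path_density Ht1 subrr mul0r expR0.
have betagt0 : 0 < beta by exact: lt_le_trans t1b.
have pdb : path_density c beta = p.
  rewrite /path_density /c lnM ?posrE ?exprn_gt0 ?H_fun_gt0// addrK lnXn//.
  by rewrite -[ln p *+ _]mulr_natr mulfK ?lnK ?posrE// pnatr_eq0 -lt0n.
have <- : annealed c t1 = corr (fun e => t1 * w e) s.
  by rewrite /annealed pd1 bernoulli_expect1 clean.
rewrite -pdb -/(annealed c beta).
apply: (le_of_is_derive t1b (df := dannealed c)) => t /andP[t1t tb].
  by apply: is_derive_annealed; exact: lt_le_trans t1t.
have t_gt0 : 0 < t by exact: lt_le_trans t1t.
apply: dannealed_ge0 => //.
rewrite /path_density -expR0 ler_expR mulr_le0_ge0// subr_le0.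
rewrite ler_ln ?posrE ?H_fun_gt0// -{1}Ht1 lerD2l lerN2 ler_expR !mulNr lerN2.
by rewrite ler_pM2l.
Qed.

End dilution_path.

(** * The clean XY model on a finite graph *)

Section xy_correlations.
Variables (R : realType) (V : finType).
Implicit Types (adj : rel V) (J : V -> V -> R) (u v : V) (t : angles R V).
Local Notation corr := (corr (@dipole V)).

(** Each ordered pair carries half of the coupling of its edge. *)
Definition xy_weight adj J (e : V * V) : R := 2^-1 * ((adj e.1 e.2)%:R * J e.1 e.2).

Definition adj_weight adj (e : V * V) : R := 2^-1 * (adj e.1 e.2)%:R.

Lemma adj_weight_ge0 adj e : 0 <= adj_weight adj e.
Proof. by rewrite mulr_ge0. Qed.

Lemma phase_unit t u : phase t (unit_charge u) = angle t u.
Proof.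
rewrite /phase (bigD1 u)//= ffunE eqxx mul1r big1 ?addr0// => v /negPf vu.
by rewrite ffunE vu mul0r.
Qed.

Lemma phase_dipole t u v : phase t (unit_charge u - unit_charge v) = angle t u - angle t v.
Proof. by rewrite phaseB !phase_unit. Qed.

Lemma xy_interactionE adj J t :
  xy_interaction adj J t = energy (@dipole V) (xy_weight adj J) t.
Proof.
rewrite /xy_interaction /energy.
under eq_bigr do rewrite big_mkcond/=.
rewrite pair_bigA/= mulr_sumr; apply: eq_bigr => -[u v] _ /=.
rewrite /xy_weight /= phase_dipole; case: adj; rewrite ?mul1r ?mul0r ?mulr0 ?mul0r//.
by rewrite mulrA.
Qed.

Lemma clean_two_pointE adj (b : R) u v :
  clean_two_point adj b u v =
  corr (fun e => b * adj_weight adj e) (unit_charge u - unit_charge v).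
Proof.
have wE : xy_weight adj (fun _ _ => b) = (fun e => b * adj_weight adj e).
  by apply/funext => e; rewrite /xy_weight /adj_weight; ring.
rewrite /clean_two_point /gibbs /corr /fourier -wE; congr (_ / _).
  by apply: eq_Rintegral => t _; rewrite phase_dipole xy_interactionE.
apply: eq_Rintegral => t _; rewrite xy_interactionE.
rewrite [X in cos X](_ : _ = 0) ?cos0 ?mul1r//.
by rewrite /phase big1// => v' _; rewrite ffunE mul0r.
Qed.

Lemma clean_two_point_ge0 adj (b : R) u v : 0 <= b -> 0 <= clean_two_point adj b u v.
Proof.
by move=> b0; rewrite clean_two_pointE corr_ge0// => e; rewrite mulr_ge0// adj_weight_ge0.
Qed.

Lemma clean_two_point_le1 adj (b : R) u v : 0 <= b -> clean_two_point adj b u v <= 1.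
Proof.
move=> b0; rewrite clean_two_pointE /corr ler_pdivrMr ?mul1r ?fourier_le//.
by apply: fourier0_gt0 => e; rewrite mulr_ge0// adj_weight_ge0.
Qed.

End xy_correlations.

(** The image of the first graph is a subgraph of the second one, and additional edges
    or vertices only increase a correlation. *)
Lemma clean_two_point_sub (R : realType) (U V : finType) (adjU : rel U) (adjV : rel V)
    (phi : U -> V) (b : R) (u u' : U) : 0 <= b -> injective phi ->
  (forall x y, adjU x y -> adjV (phi x) (phi y)) ->
  clean_two_point adjU b u u' <= clean_two_point adjV b (phi u) (phi u').
Proof.
move=> b0 phi_inj hom; rewrite !clean_two_pointE.
pose wV (e : V * V) : R := b * (2^-1 *
  [exists x, exists y, [&& adjU x y, phi x == e.1 & phi y == e.2]]%:R).
rewrite -(@corr_embedding _ _ _ phi phi_inj _ wV).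
- apply: corr_mono => e; rewrite /wV ?mulr_ge0// ler_wpM2l// /adj_weight ler_wpM2l ?invr_ge0//.
  rewrite ler_nat; case: existsP => // -[x /existsP[y /and3P[xy /eqP <- /eqP <-]]].
  by rewrite hom.
- move=> x y; rewrite /wV /adj_weight/=; congr (_ * (_ * (nat_of_bool _)%:R)).
  apply/existsP/idP => [[x' /existsP[y' /and3P[xy]]]|xy].
    by rewrite !(inj_eq phi_inj) => /eqP <- /eqP <-.
  by exists x; apply/existsP; exists y; rewrite xy !eqxx.
- move=> e ne; rewrite /wV; case: existsP; last by rewrite !mulr0.
  move=> [x /existsP[y /and3P[_ /eqP e1 /eqP e2]]]; exfalso.
  by case: ne; rewrite -?e1 -?e2 codom_f.
Qed.

(** * Geometry of boxes *)

Section box_geometry.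
Variable r : nat.
Implicit Types (u v : box r) (x : int * int).

Definition sup_norm x : nat := maxn `|x.1|%N `|x.2|%N.

Lemma sup_normD x y : (sup_norm (x + y)%R <= sup_norm x + sup_norm y)%N.
Proof. case: x y => [a b] [c d]; rewrite /sup_norm/=; lia. Qed.

Lemma sup_normN x : sup_norm (- x)%R = sup_norm x.
Proof. by case: x => a b; rewrite /sup_norm/= !abszN. Qed.

Lemma box_posK u : box_vertex r (box_pos u) = u.
Proof.
by case: u => a b; rewrite /box_vertex /box_pos/= !subrK; congr pair; exact: inord_val.
Qed.

Lemma box_pos_inj : injective (@box_pos r).
Proof. exact: can_inj box_posK. Qed.

Lemma box_pos_norm u : (sup_norm (box_pos u) <= r)%N.
Proof.
case: u => a b; rewrite /sup_norm /box_pos/=; have := ltn_ord a; have := ltn_ord b; lia.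
Qed.

Lemma box_vertexK x : (sup_norm x <= r)%N -> box_pos (box_vertex r x) = x.
Proof.
case: x => a b; rewrite /sup_norm geq_max/= /box_pos /box_vertex/= => /andP[ha hb].
rewrite !inordK; first by congr pair; lia.
  lia.
lia.
Qed.

Lemma box_originE : box_pos (box_origin r) = 0.
Proof. by rewrite box_vertexK. Qed.

Lemma box_adjE u v : box_adj u v =
  (`|(box_pos u - box_pos v).1| + `|(box_pos u - box_pos v).2| == 1).
Proof. by []. Qed.

End box_geometry.

Section box_translation.
Variables (k r : nat) (c : int * int).
Hypothesis ckr : (sup_norm c + k <= r)%N.

Definition box_shift (y : box k) : box r := box_vertex r (c + box_pos y).

Lemma box_pos_shift y : box_pos (box_shift y) = c + box_pos y.
Proof.
apply: box_vertexK; apply: leq_trans (sup_normD _ _) _.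
by apply: leq_trans ckr; rewrite leq_add2l box_pos_norm.
Qed.

Lemma box_shift_inj : injective box_shift.
Proof.
move=> y y' /(congr1 (@box_pos r)); rewrite !box_pos_shift => /addrI.
exact: box_pos_inj.
Qed.

Lemma box_shift_adj y y' : box_adj (box_shift y) (box_shift y') = box_adj y y'.
Proof.
rewrite !box_adjE !box_pos_shift.
by rewrite opprD addrACA subrr add0r.
Qed.

Lemma box_shift_codom v :
  (v \in codom box_shift) = (sup_norm (box_pos v - c)%R <= k)%N.
Proof.
apply/codomP/idP => [[y ->]|vc].
  by rewrite box_pos_shift addrC addKr box_pos_norm.
exists (box_vertex k (box_pos v - c)); apply: box_pos_inj.
by rewrite box_pos_shift box_vertexK// addrC subrK.
Qed.

End box_translation.

Lemma box_shift_center k r (u : box r) : box_shift r (box_pos u) (box_origin k) = u.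
Proof. by rewrite /box_shift box_originE addr0 box_posK. Qed.

(** * Exponential decay from a shell sum below one *)

Section charge_values.
Variable V : finType.
Implicit Types a b : {ffun V -> int}.

Lemma chargeDE a b v : (a + b) v = a v + b v. Proof. exact: ffunE. Qed.

Lemma chargeNE a v : (- a) v = - a v. Proof. exact: ffunE. Qed.

End charge_values.

(** If every hop of nonzero weight preserves l, a charge on which l does not vanish
    never reaches 0. *)
Lemma fourier_conserved (R : realType) (V I : finType)
    (chi : I -> {ffun V -> int}) (w : I -> R) (l : {ffun V -> int} -> int)
    (s : {ffun V -> int}) :
  l 0 = 0 ->
  (forall i s, w i != 0 -> l (s + chi i) = l s /\ l (s - chi i) = l s) ->
  l s != 0 -> fourier chi w s = 0.
Proof.
move=> l0 lchi ls; have c := @cvg_free_moment _ _ _ chi w s.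
suff E k : free_moment chi w k s = 0.
  rewrite -(cvg_lim (@Rhausdorff R) c).
  rewrite (_ : (fun n => _) = (fun=> 0)); first exact: lim_cst.
  by apply/funext => n; rewrite big1// => k _; rewrite E mulr0.
elim: k s ls {c} => [|k ih] s ls; rewrite /free_moment/=.
  by have [s0|//] := eqVneq s 0; move: ls; rewrite s0 l0 eqxx.
rewrite /hop big1// => i _; have [->|wi] := eqVneq (w i) 0; first by rewrite !mul0r.
have [e1 e2] := lchi i s wi.
by rewrite -!/(free_moment _ _ _ _) !ih ?e1 ?e2// addr0 mulr0.
Qed.

Lemma corr_lieb (R : realType) (V : finType) (wA wC : V * V -> R) (S : {set V})
    (x z : V) : (forall e, 0 <= wA e) -> (forall e, 0 <= wC e) ->
  (forall e, (e.1 \in S) || (e.2 \in S) -> wC e = 0) -> z \notin S ->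
  corr (@dipole V) (fun e => wA e + wC e) (unit_charge x - unit_charge z) <=
  \sum_(b | b \notin S) corr (@dipole V) wA (unit_charge x - unit_charge b) *
    corr (@dipole V) (fun e => wA e + wC e) (unit_charge b - unit_charge z).
Proof.
move=> wA0 wC0 wCS zS; have H := lieb x wA0 wC0 wCS zS.
have ZA : 0 < fourier (@dipole V) wA 0 by exact: fourier0_gt0.
have Z : 0 < fourier (@dipole V) (fun e => wA e + wC e) 0.
  by apply: fourier0_gt0 => e; rewrite addr_ge0.
have cancel (a c y y' : R) : 0 < y -> 0 < y' -> a / y * (c / y') * y' * y = a * c.
  by move=> y0 y'0; field; rewrite !gt_eqF.
rewrite /corr ler_pdivrMr// -(ler_pM2r ZA); apply: le_trans H _.
rewrite le_eqVlt; apply/orP; left; apply/eqP; rewrite !mulr_suml.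
by apply: eq_bigr => b _; rewrite (cancel _ _ _ _ ZA Z).
Qed.

Section exponential_decay.
Variables (R : realType) (k : nat) (b : R).
Hypotheses (k_gt0 : (0 < k)%N) (b_ge0 : 0 <= b).

Definition shell_sum : R :=
  \sum_(y : box k | sup_norm (box_pos y) == k)
    clean_two_point (@box_adj k) b (box_origin k) y.

Lemma shell_sum_ge0 : 0 <= shell_sum.
Proof. by apply: sumr_ge0 => y _; exact: clean_two_point_ge0. Qed.

(** The Lieb-Rivasseau inequality with S the open ball of radius k around u: the
    inner edges are those of the translated box, and the only boundary points
    reached by them form its shell. *)
Lemma shell_step r (u z : box r) : (sup_norm (box_pos u) + k <= r)%N ->
  (k <= sup_norm (box_pos u - box_pos z)%R)%N ->
  clean_two_point (@box_adj r) b u z <=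
  \sum_(y : box k | sup_norm (box_pos y) == k)
    clean_two_point (@box_adj k) b (box_origin k) y *
    clean_two_point (@box_adj r) b (box_shift r (box_pos u) y) z.
Proof.
move=> ukr kuz.
(* Edges with both ends in the closed ball of radius k around u; the others do not
   touch the open ball S. *)
pose inner (e : box r * box r) :=
  (e.1 \in codom (@box_shift k r (box_pos u))) && (e.2 \in codom (@box_shift k r (box_pos u))).
pose wA e : R := b * adj_weight R (@box_adj r) e * (inner e)%:R.
pose wC e : R := b * adj_weight R (@box_adj r) e * (~~ inner e)%:R.
have w0 e : 0 <= b * adj_weight R (@box_adj r) e by rewrite mulr_ge0// adj_weight_ge0.
have wA0 e : 0 <= wA e by rewrite mulr_ge0.
have wC0 e : 0 <= wC e by rewrite mulr_ge0.
pose S : {set box r} := [set v | (sup_norm (box_pos v - box_pos u)%R < k)%N]%SET.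
have adj1 (v v' : box r) : box_adj v v' -> (sup_norm (box_pos v - box_pos v')%R <= 1)%N.
  rewrite box_adjE /sup_norm; case: (box_pos v - box_pos v') => [c d] /=; lia.
have nb (v v' : box r) : v \in S -> (sup_norm (box_pos v' - box_pos v)%R <= 1)%N ->
    v \in codom (@box_shift k r (box_pos u)) /\ v' \in codom (@box_shift k r (box_pos u)).
  rewrite inE => vS vv'; rewrite !box_shift_codom// (ltnW vS); split => //.
  rewrite -(subrK (box_pos v) (box_pos v')) -addrA.
  apply: leq_trans (sup_normD _ _) _.
  by apply: leq_trans vS; rewrite -[X in (_ <= X)%N]add1n leq_add.
have wCS e : (e.1 \in S) || (e.2 \in S) -> wC e = 0.
  rewrite /wC /adj_weight /inner => eS.
  have [adj|] := boolP (box_adj e.1 e.2); last by rewrite !mulr0 mul0r.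
  have a1 := adj1 _ _ adj.
  have a2 : (sup_norm (box_pos e.2 - box_pos e.1)%R <= 1)%N by rewrite -sup_normN opprB.
  by case/orP: eS => /nb H; [have [-> ->] := H _ a2 | have [-> ->] := H _ a1]; rewrite mulr0.
have zS : z \notin S.
  by rewrite inE -leqNgt -sup_normN opprB.
have wE : (fun e => wA e + wC e) = (fun e => b * adj_weight R (@box_adj r) e).
  by apply/funext => e; rewrite /wA /wC; case: (inner e); rewrite /= mulr0 mulr1 ?addr0 ?add0r.
have := corr_lieb u wA0 wC0 wCS zS; rewrite wE -clean_two_pointE => /le_trans; apply.
have phi_inj := box_shift_inj ukr.
have uE : u = box_shift r (box_pos u) (box_origin k).
  by rewrite box_shift_center.
pose sh : {set box r} := [set box_shift r (box_pos u) y | y in [set y : box k | sup_norm (box_pos y) == k]]%SET.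
rewrite (bigID (mem sh))/= [X in _ + X]big1 ?addr0.
  rewrite (eq_bigl (mem sh)).
    rewrite big_imset/=; last by move=> y y' _ _; exact: phi_inj.
    rewrite (eq_bigl (fun y : box k => sup_norm (box_pos y) == k)); last by move=> y; rewrite inE.
    apply: ler_sum => y _; rewrite -clean_two_pointE ler_wpM2r ?clean_two_point_ge0//.
    rewrite clean_two_pointE {1}uE.
    rewrite (@corr_embedding _ _ _ _ phi_inj (fun e => b * adj_weight R (@box_adj k) e))//.
      by move=> y1 y2; rewrite /wA /inner/= !codom_f mulr1 /adj_weight/= box_shift_adj.
    move=> e ne; rewrite /wA /inner; case: andP; last by rewrite mulr0.
    by case=> e1 e2; case: ne; rewrite ?e1 ?e2.
  move=> v /=; apply: andb_idl => /imsetP[y]; rewrite inE => /eqP yk ->.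
  by rewrite inE box_pos_shift// addrC addKr yk ltnn.
move=> v /andP[vS vsh].
have vc : v \notin codom (@box_shift k r (box_pos u)).
  apply: contra vsh => /codomP[y vy]; apply/imsetP; exists y => //.
  move: vS; rewrite vy !inE box_pos_shift// addrC addKr -leqNgt => ky.
  by rewrite eqn_leq ky box_pos_norm.
rewrite [X in X * _](_ : _ = 0) ?mul0r// /corr.
rewrite (fourier_conserved (l := fun s => s v)) ?mul0r//.
- by rewrite ffunE.
- move=> e s we; have de : dipole e v = 0.
    have /andP[e1 e2] : inner e by apply: contraNT we => /negPf ie; rewrite /wA ie mulr0.
    have v1 : v != e.1 by apply: contraNneq vc => ->.
    have v2 : v != e.2 by apply: contraNneq vc => ->.
    by rewrite dipoleE (negPf v1) (negPf v2).
  by rewrite (chargeDE s (dipole e)) (chargeDE s (- dipole e)) (chargeNE (dipole e)) de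
    oppr0 addr0.
- have vu : v != u by apply: contraNneq vc => ->; rewrite [X in X \in _]uE codom_f.
  by rewrite !ffunE eqxx (negPf vu).
Qed.

(** Each application of [shell_step] gains a factor [shell_sum] and brings the
    source at most k closer to z; the box must be large enough to contain all
    intermediate boxes. *)
Lemma shell_decay n r (u z : box r) : (sup_norm (box_pos u) + n * k <= r)%N ->
  (n * k <= sup_norm (box_pos u - box_pos z)%R)%N ->
  clean_two_point (@box_adj r) b u z <= shell_sum ^+ n.
Proof.
elim: n u => [|n ih] u ukr kuz; first by rewrite expr0 clean_two_point_le1.
have ukr1 : (sup_norm (box_pos u) + k <= r)%N.
  by apply: leq_trans ukr; rewrite leq_add2l mulSn leq_addr.
apply: le_trans (shell_step ukr1 _) _.
  by apply: leq_trans kuz; rewrite mulSn leq_addr.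
rewrite exprS /shell_sum mulr_suml; apply: ler_sum => y /eqP yk.
rewrite ler_wpM2l ?clean_two_point_ge0//; apply: ih; rewrite box_pos_shift//.
  apply: leq_trans ukr; rewrite mulSn addnA leq_add2r.
  by apply: leq_trans (sup_normD _ _) _; rewrite yk.
rewrite -(leq_add2l k) -mulSn; apply: leq_trans kuz _.
rewrite -[X in (_ <= X + _)%N]yk -(sup_normN (box_pos y)) addnC.
apply: leq_trans (sup_normD _ _); apply/eq_leq; congr sup_norm.
by rewrite [RHS]addrAC addrK.
Qed.

(** The limit operator returns 0 on a divergent sequence, so the bounds hold whether
    or not the sequence converges. *)
Lemma limn_bounds (f : nat -> R) (M : R) (N : nat) : 0 <= M ->
  (forall n, (N <= n)%N -> 0 <= f n <= M) -> 0 <= limn f <= M.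
Proof.
move=> M0 fM; have [cf|ncf] := pselect (cvgn f).
  apply/andP; split.
    apply: limr_ge => //; near=> n.
    have /fM/andP[] // : (N <= n)%N by near: n; exact: nbhs_infty_ge.
  apply: limr_le => //; near=> n.
  have /fM/andP[] // : (N <= n)%N by near: n; exact: nbhs_infty_ge.
suff -> : limn f = 0 by rewrite lexx.
by rewrite dvgP.
Unshelve. all: by end_near. Qed.

Lemma euclidean_norm_le (x : int * int) : euclidean_norm R x <= 2 * (sup_norm x)%:R.
Proof.
rewrite /euclidean_norm -[leRHS]ger0_norm ?mulr_ge0// -sqrtr_sqr ler_wsqrtr//.
have h (a : int) : (`|a| <= sup_norm x)%N -> a%:~R ^+ 2 <= (sup_norm x)%:R ^+ 2 :> R.
  move=> ax; rewrite -real_normK ?num_real// ler_sqr ?nnegrE//.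
  by rewrite -intr_norm -abszE -[X in _ <= X]/((sup_norm x)%:R) -pmulrn ler_nat.
have := h x.1 (leq_maxl _ _); have := h x.2 (leq_maxr _ _); nra.
Qed.

Lemma exponential_decay_of_shell : shell_sum < 1 ->
  exponential_decay (two_point_free b).
Proof.
(* The rate is - ln q, so q must not vanish. *)
move=> q1; pose q : R := Num.max shell_sum 2^-1.
have q_gt0 : 0 < q by rewrite lt_max invr_gt0 ltr0n orbT.
have q_lt1 : q < 1 by rewrite gt_max q1 invf_lt1// ltr1n.
have lq : ln q < 0 by rewrite ln_lt0// q_gt0.
have kR : 0 < k%:R :> R by rewrite ltr0n.
exists q^-1, (- ln q / (2 * k%:R)); split.
  by rewrite divr_gt0 ?mulr_gt0// oppr_gt0.
move=> x; set n := (sup_norm x %/ k)%N.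
have nk : (n * k <= sup_norm x)%N by exact: leq_trunc_div.
have /andP[l0 lq'] : 0 <= two_point_free b x <= q ^+ n.
  apply: (@limn_bounds _ _ (sup_norm x)) => [|r xr]; first by rewrite exprn_ge0// ltW.
  rewrite clean_two_point_ge0//=; apply: (@le_trans _ _ (shell_sum ^+ n)).
    apply: shell_decay; rewrite box_originE.
      by rewrite [sup_norm 0](_ : _ = 0%N)// add0n (leq_trans nk).
    by rewrite sub0r sup_normN box_vertexK.
  have sq : shell_sum <= q by rewrite /q le_max lexx.
  by rewrite lerXn2r ?nnegrE ?shell_sum_ge0// ltW.
rewrite ger0_norm//; apply: le_trans lq' _.
rewrite -(lnK (q_gt0 : q \in Num.pos)) -expRM_natl -expRN -expRD ler_expR expRK.
have sx : (sup_norm x)%:R <= (n%:R + 1) * k%:R :> R.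
  rewrite natr1 -natrM ler_nat; have := ltn_ceil (sup_norm x) k_gt0.
  exact: ltnW.
have ex := euclidean_norm_le x.
have -> : - (- ln q / (2 * k%:R)) * euclidean_norm R x =
   ln q / k%:R * (euclidean_norm R x / 2) by field; rewrite gt_eqF.
rewrite -lerBlDl opprK.
have -> : n%:R * ln q + ln q = ln q / k%:R * ((n%:R + 1) * k%:R).
  by field; rewrite gt_eqF.
have lqk : ln q / k%:R <= 0 by rewrite ler_pdivrMr// mul0r ltW.
by apply: (ler_wnM2l lqk); lra.
Qed.

End exponential_decay.

(** * The critical point and sums over shells *)

Lemma sum_inj_le (R : realType) (S T : finType) (f : S -> T) (P : pred S)
    (Q : pred T) (G : T -> R) : injective f -> (forall y, 0 <= G y) ->
  (forall x, P x -> Q (f x)) -> \sum_(x | P x) G (f x) <= \sum_(y | Q y) G y.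
Proof.
move=> f_inj G0 PQ; rewrite (bigID (mem [set f x | x in P]%SET))/=.
rewrite (eq_bigl (mem [set f x | x in P]%SET)); last first.
  by move=> y /=; apply: andb_idl => /imsetP[x xP ->]; exact: PQ.
rewrite big_imset/=; last by move=> x y _ _; exact: f_inj.
by rewrite lerDl; apply: sumr_ge0.
Qed.

Section critical_shell.
Variables (R : realType) (b0 : R).
Hypothesis hb0 : beta_BKT R = b0%:E.

(** The supremum is finite, so it is taken over a nonempty set of nonnegative
    numbers. *)
Lemma critical_ge0 : 0 <= b0.
Proof.
have fin : ereal_sup [set b%:E | b in
    [set b : R | 0 <= b /\ exponential_decay (two_point_free b)]] \is a fin_num.
  by rewrite -/(beta_BKT R) hb0.
have [x [b [b_ge0 bD] <-] _] := ub_ereal_sup_adherent (ltr01 : 0 < 1 :> R) fin.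
apply: (le_trans (b_ge0 : 0 <= b)); rewrite -lee_fin -hb0 /beta_BKT.
by apply: ereal_sup_ubound; exists b.
Qed.

Lemma continuous_shell_sum (k : nat) (b : R) : 0 <= b -> {for b, continuous (@shell_sum R k)}.
Proof.
move=> b_ge0; pose w := adj_weight R (@box_adj k).
have D y : is_derive b (1 : R) (fun b => clean_two_point (@box_adj k) b (box_origin k) y)
   (covariance_with (unit_charge (box_origin k) - unit_charge y)
      (fun e => 0 + b * w e) w).
  rewrite (_ : (fun b => _) = (fun h => corr (@dipole (box k)) (fun e => 0 + h * w e)
     (unit_charge (box_origin k) - unit_charge y))); last first.
    apply/funext => h; rewrite clean_two_pointE.
    have -> // : (fun e => 0 + h * w e) = (fun e => h * w e).
    by apply/funext => e; rewrite add0r.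
  apply: is_derive_corr; rewrite gt_eqF// fourier0_gt0// => e.
  by rewrite add0r mulr_ge0// adj_weight_ge0.
have := @is_derive_bigsum R _ (index_enum (box k))
  (fun y => sup_norm (box_pos y) == k) _ _ b D.
by case=> dS _; apply/differentiable_continuous/derivable1_diffP.
Qed.

(** A shell sum below 1 at b0 would remain below 1 slightly above b0, and exponential
    decay would hold beyond the supremum. *)
Lemma critical_shell_ge1 k : (0 < k)%N -> 1 <= shell_sum k b0.
Proof.
move=> k0; rewrite leNgt; apply/negP => q1.
have c : {for b0, continuous (@shell_sum R k)} by exact: continuous_shell_sum critical_ge0.
have lt1 : \forall b \near b0, shell_sum k b < 1 by exact: cvgr_lt c _ q1.
have [b [b1 b0b]] : exists b : R, shell_sum k b < 1 /\ b0 < b.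
  apply: (@filter_ex _ (b0^'+)); near=> b; split; last first.
    by near: b; exact: nbhs_right_gt.
  by near: b; exact: cvg_at_right_filter lt1.
have b_ge0 : 0 <= b by rewrite (le_trans critical_ge0)// ltW.
have : (b%:E <= b0%:E)%E.
  rewrite -hb0 /beta_BKT; apply: ereal_sup_ubound; exists b => //; split => //.
  exact: exponential_decay_of_shell k0 b_ge0 b1.
by rewrite lee_fin leNgt b0b.
Unshelve. all: by end_near. Qed.

End critical_shell.

(** Split the embedded box into its r shells.  The shell of radius k, seen from the
    centre, contains the shell of the concentric box of radius k, whose
    correlations are smaller. *)
Lemma box_sum_ge (R : realType) (V : finType) (adj : rel V) (r : nat) (phi : box r -> V)
    (b : R) (F : V -> R) : 0 <= b ->
  (forall k, (0 < k)%N -> 1 <= shell_sum k b) ->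
  injective phi -> (forall y y', box_adj y y' -> adj (phi y) (phi y')) ->
  (forall v, 0 <= F v) ->
  (forall v, v != phi (box_origin r) -> clean_two_point adj b (phi (box_origin r)) v <= F v) ->
  r%:R + F (phi (box_origin r)) <= \sum_v F v.
Proof.
move=> b_ge0 shell1 phi_inj hom F0 FG.
apply: (@le_trans _ _ (\sum_(y : box r) F (phi y))); last first.
  exact: (@sum_inj_le _ _ _ phi predT predT F).
rewrite (bigD1 (box_origin r))//= [leLHS]addrC lerD2l.
rewrite (partition_big (fun y : box r => inord (sup_norm (box_pos y)) : 'I_r.+1) predT)//=.
rewrite big_ord_recl/= -[leLHS]add0r lerD//; first exact: sumr_ge0.
rewrite -[leLHS](_ : \sum_(i < r) (1 : R) = _); last by rewrite sumr_const card_ord.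
apply: ler_sum => i _.
have ir : (sup_norm 0%R + i.+1 <= r)%N by rewrite [sup_norm 0](_ : _ = 0%N)// add0n.
apply: le_trans (shell1 i.+1 isT) _.
pose iota := @box_shift i.+1 r 0.
have iota0 : iota (box_origin i.+1) = box_origin r.
  by apply: box_pos_inj; rewrite box_pos_shift// !box_originE addr0.
have iota_norm y : box_pos (iota y) = box_pos y by rewrite box_pos_shift// add0r.
apply: (@le_trans _ _ (\sum_(y : box i.+1 | sup_norm (box_pos y) == i.+1) F (phi (iota y)))).
  apply: ler_sum => y /eqP yi.
  have y0 : phi (iota y) != phi (box_origin r).
    rewrite (inj_eq phi_inj) -iota0 (inj_eq (box_shift_inj ir)).
    by apply/eqP => e; move: yi; rewrite e box_originE.
  apply: le_trans (FG _ y0); rewrite -iota0.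
  apply: (@clean_two_point_sub _ _ _ _ _ (phi \o iota)) => //.
    by apply: inj_comp => //; exact: box_shift_inj.
  by move=> x y' xy /=; apply: hom; rewrite box_shift_adj.
apply: (@sum_inj_le _ _ _ iota _ _ (fun y => F (phi y))) => //.
  exact: box_shift_inj.
move=> y /eqP yi; apply/andP; split.
  apply/eqP => e; have := iota_norm y; rewrite e box_originE => y0.
  by move: yi; rewrite -y0.
by apply/eqP/val_inj; rewrite iota_norm yi /= inordK.
Qed.

(** * Spin observables of the model in a field *)

Section gibbs_observables.
Variables (R : realType) (V : finType).
Implicit Types (t : angles R V).

Lemma gibbs_normalization (I : finType) (chi : I -> {ffun V -> int}) (w : I -> R)
    (W : angles R V -> R) : (forall t, W t = energy chi w t) ->
  Rintegral (@angles_prob R #|V|) setT (fun t => expR (W t)) = fourier chi w 0.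
Proof.
move=> WE; apply: eq_Rintegral => t _; rewrite WE.
rewrite [X in cos X](_ : _ = 0) ?cos0 ?mul1r//.
by rewrite /phase big1// => v' _; rewrite ffunE mul0r.
Qed.

Lemma gibbs_cos_sum (I J : finType) (chi : I -> {ffun V -> int}) (w : I -> R)
    (c : J -> R) (s : J -> {ffun V -> int}) (f W : angles R V -> R) :
  (forall t, W t = energy chi w t) ->
  (forall t, f t = \sum_j c j * cos (phase t (s j))) ->
  gibbs W f = \sum_j c j * corr chi w (s j).
Proof.
move=> WE fE; rewrite /gibbs (gibbs_normalization WE) /corr.
under [RHS]eq_bigr do rewrite mulrA.
rewrite -mulr_suml; congr (_ / _).
have b j : bounded_measurable (fun t => cos (phase t (s j)) * expR (energy chi w t)).
  apply: bmM; last exact/bm_exp/bm_energy.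
  by under eq_fun do rewrite -[phase _ _]addr0; exact: bm_cos_phase.
transitivity (\int[angles_prob R #|V|]_t
    (\sum_j c j * (cos (phase t (s j)) * expR (energy chi w t)))).
  apply: eq_Rintegral => t _; rewrite fE WE mulr_suml.
  by apply: eq_bigr => j _; rewrite mulrA.
rewrite Rintegral_sum => [|j]; last by apply: bmM => //; exact: bm_cst.
by apply: eq_bigr => j _; rewrite RintegralZl//; exact: bm_integrable.
Qed.

Lemma gibbs_sin (I : finType) (chi : I -> {ffun V -> int}) (w : I -> R)
    (c : R) (s : {ffun V -> int}) (f W : angles R V -> R) :
  (forall t, W t = energy chi w t) ->
  (forall t, f t = c * sin (phase t s)) -> gibbs W f = 0.
Proof.
move=> WE fE; rewrite /gibbs (_ : Rintegral _ _ _ = 0) ?mul0r//.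
transitivity (\int[angles_prob R #|V|]_t
    (c * (cos (phase t s + - (pi / 2)) * expR (energy chi w t)))).
  by apply: eq_Rintegral => t _; rewrite fE WE cosBpihalf mulrA.
rewrite RintegralZl//; last first.
  by apply: bm_integrable; apply: bmM; [exact: bm_cos_phase | exact/bm_exp/bm_energy].
rewrite -[X in _ * X]/(fourier_shift chi w (- (pi / 2)) s) fourier_shiftE.
by rewrite cosN cos_pihalf mul0r mulr0.
Qed.

End gibbs_observables.

Section spins.
Variables (R : realType) (V : finType) (adj : rel V) (beta : R).
Variables (J : V -> V -> R) (eta : V -> R).
Implicit Types (t : angles R V) (x y : V).
Local Notation edge_corr := (corr (@dipole V) (xy_weight adj J)).
Local Notation two_spin x y := (fun z : V -> R[i] => complex.Re (z x * conjc (z y))).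

Lemma interaction0E t :
  xy_interaction adj J t + beta * 0 * \sum_x complex.Re (spin eta t x) =
  energy (@dipole V) (xy_weight adj J) t.
Proof. by rewrite mulr0 mul0r addr0 xy_interactionE. Qed.

Lemma Re_two_spin t x y : complex.Re (spin eta t x * conjc (spin eta t y)) =
  eta x * eta y * cos (phase t (unit_charge x - unit_charge y)).
Proof. by rewrite phase_dipole /spin /= cosB; ring. Qed.

Lemma Im_two_spin t x y : complex.Im (spin eta t x * conjc (spin eta t y)) =
  eta x * eta y * sin (phase t (unit_charge x - unit_charge y)).
Proof. by rewrite phase_dipole /spin /= sinB; ring. Qed.

Lemma gibbs_field_two_spin x y :
  gibbs_field adj beta J eta 0 (two_spin x y) =
  eta x * eta y * edge_corr (unit_charge x - unit_charge y).
Proof.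
rewrite /gibbs_field (@gibbs_cos_sum _ _ _ 'I_1 (@dipole V) (xy_weight adj J)
  (fun=> eta x * eta y) (fun=> unit_charge x - unit_charge y)); first by rewrite big_ord1.
  exact: interaction0E.
by move=> t; rewrite big_ord1 Re_two_spin.
Qed.

Lemma gibbs_field_Im x y :
  gibbs_field adj beta J eta 0 (fun z => complex.Im (z x * conjc (z y))) = 0.
Proof.
rewrite /gibbs_field (@gibbs_sin _ _ _ (@dipole V) (xy_weight adj J)
  (eta x * eta y) (unit_charge x - unit_charge y))//.
  exact: interaction0E.
by move=> t; rewrite Im_two_spin.
Qed.

Lemma sqr_modulusE (z : R[i]) : sqr_modulus z = complex.Re (z * conjc z).
Proof.
case: z => a b; rewrite /sqr_modulus normc_def -rmorphXn /= sqr_sqrtr ?addr_ge0 ?sqr_ge0//.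
by ring.
Qed.

Lemma Re_sum (I : Type) (r : seq I) (P : pred I) (f : I -> R[i]) :
  complex.Re (\sum_(i <- r | P i) f i) = \sum_(i <- r | P i) complex.Re (f i).
Proof. by apply: (big_morph (@complex.Re R)) => // -[a b] [c d]. Qed.

Lemma sqr_modulus_sum (z : V -> R[i]) :
  sqr_modulus (\sum_x z x) = \sum_x \sum_y complex.Re (z x * conjc (z y)).
Proof.
rewrite sqr_modulusE rmorph_sum mulr_suml Re_sum; apply: eq_bigr => x _.
by rewrite mulr_sumr Re_sum.
Qed.

Lemma gibbs_field_double_sum (c : R) :
  gibbs_field adj beta J eta 0 (fun z => c * \sum_x \sum_y complex.Re (z x * conjc (z y))) =
  c * \sum_x \sum_y gibbs_field adj beta J eta 0 (two_spin x y).
Proof.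
rewrite [LHS]/gibbs_field (@gibbs_cos_sum _ _ _ (V * V)%type (@dipole V) (xy_weight adj J)
  (fun e => c * (eta e.1 * eta e.2)) (fun e => unit_charge e.1 - unit_charge e.2)).
- rewrite pair_bigA/= mulr_sumr; apply: eq_bigr => e _.
  by rewrite gibbs_field_two_spin !mulrA.
- exact: interaction0E.
- move=> t; rewrite pair_bigA mulr_sumr; apply: eq_bigr => e _.
  rewrite -[X in c * X]/(complex.Re (spin eta t e.1 * conjc (spin eta t e.2))).
  by rewrite Re_two_spin mulrA.
Qed.

(** A magnetic field is a coupling to the unit charges, so the model in a field is
    again a Gibbs weight with cosine energy. *)
Definition field_charge (i : V * V + V) : {ffun V -> int} :=
  match i with inl e => dipole e | inr x => unit_charge x end.

Definition join_weight (w : V * V -> R) (c : V -> R) (i : V * V + V) : R :=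
  match i with inl e => w e | inr x => c x end.

Lemma energy_join w c t : energy field_charge (join_weight w c) t =
  energy (@dipole V) w t + \sum_x c x * cos (angle t x).
Proof.
rewrite /energy big_sumType/=; congr (_ + _).
by apply: eq_bigr => x _; rewrite phase_unit.
Qed.

Lemma fourier_join0 (w : V * V -> R) :
  fourier field_charge (join_weight w (fun=> 0)) = fourier (@dipole V) w.
Proof.
apply/funext => s; apply: eq_Rintegral => t _; rewrite energy_join big1 ?addr0// => x _.
by rewrite mul0r.
Qed.

Lemma sum_unit_charge (u : V) : \sum_v unit_charge u v = 1.
Proof.
by rewrite (bigD1 u)//= ffunE eqxx big1 ?addr0// => v /negPf vu; rewrite ffunE vu.
Qed.

(** Dipoles have total charge 0. *)
Lemma fourier_total_charge (w : V * V -> R) (s : {ffun V -> int}) : \sum_v s v != 0 ->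
  fourier (@dipole V) w s = 0.
Proof.
move=> s0; apply: (fourier_conserved (l := fun s => \sum_v s v)) => //.
  by rewrite big1// => v _; rewrite ffunE.
move=> e s' _.
have d0 : \sum_v dipole e v = 0.
  transitivity (\sum_v (unit_charge e.1 v - unit_charge e.2 v)).
    by apply: eq_bigr => v _; rewrite !ffunE.
  by rewrite sumrB !sum_unit_charge subrr.
split.
  transitivity (\sum_v (s' v + dipole e v)).
    by apply: eq_bigr => v _; exact: chargeDE.
  by rewrite big_split/= d0 addr0.
transitivity (\sum_v (s' v - dipole e v)).
  by apply: eq_bigr => v _; rewrite (chargeDE s') (chargeNE (dipole e)).
by rewrite sumrB d0 subr0.
Qed.

(** Linear response: the derivative at 0 is the covariance of the magnetization with
    the field energy.  Terms of nonzero total charge vanish, which leaves half of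
    the two-spin sum. *)
Lemma is_derive_gibbs_field (c : R) : (forall e, 0 <= xy_weight adj J e) ->
  is_derive (0 : R) (1 : R)
    (fun h => gibbs_field adj beta J eta h (fun z => c * \sum_x complex.Re (z x)))
    (beta / 2 * (c * \sum_x \sum_y gibbs_field adj beta J eta 0 (two_spin x y))).
Proof.
move=> w0; set w := xy_weight adj J.
pose v0 := join_weight w (fun=> 0).
pose v1 := join_weight (fun=> 0) (fun x => beta * eta x).
have E h : gibbs_field adj beta J eta h (fun z => c * \sum_x complex.Re (z x)) =
    \sum_x c * eta x * corr field_charge (fun i => v0 i + h * v1 i) (unit_charge x).
  rewrite /gibbs_field; apply: gibbs_cos_sum => t.
    rewrite energyD energyZ !energy_join xy_interactionE -!addrA; congr (_ + _).
    rewrite [X in _ = X + _]big1 ?add0r => [|x _]; last by rewrite mul0r.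
    rewrite [energy _ (fun=> 0) _]big1 ?add0r => [|e _]; last by rewrite mul0r.
    by rewrite !mulr_sumr; apply: eq_bigr => x _; rewrite /spin/=; ring.
  by rewrite mulr_sumr; apply: eq_bigr => x _; rewrite phase_unit /spin/= mulrA.
rewrite (_ : (fun h => _) = (fun h => \sum_x c * eta x *
   corr field_charge (fun i => v0 i + h * v1 i) (unit_charge x))); last first.
  by apply/funext => h; rewrite E.
have v00 : (fun i => v0 i + 0 * v1 i) = v0 by apply/funext => i; rewrite mul0r addr0.
have Z0 : 0 < fourier (@dipole V) w 0 by exact: fourier0_gt0.
have ZE : fourier field_charge v0 = fourier (@dipole V) w by exact: fourier_join0.
have D x : is_derive (0 : R) (1 : R)
    (fun h => corr field_charge (fun i => v0 i + h * v1 i) (unit_charge x))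
    (\sum_y beta / 2 * eta y * edge_corr (unit_charge x - unit_charge y)).
  have := @is_derive_corr R V _ field_charge v0 v1 (unit_charge x) 0.
  rewrite v00 ZE => /(_ (lt0r_neq0 Z0)); congr is_derive.
  have zx : fourier (@dipole V) w (unit_charge x) = 0.
    by apply: fourier_total_charge; rewrite sum_unit_charge.
  rewrite /corr ZE zx mul0r mul0r subr0 /response v00 ZE /hop big_sumType/=.
  rewrite big1 ?add0r => [|e _]; last by rewrite !mul0r.
  rewrite mulr_suml; apply: eq_bigr => y _.
  rewrite (@fourier_total_charge w (unit_charge x + unit_charge y)); last first.
    rewrite (eq_bigr (fun v => unit_charge x v + unit_charge y v)).
      by rewrite big_split/= !sum_unit_charge.
    by move=> v _; exact: chargeDE.
  rewrite add0r /corr -/w; field.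
  exact: lt0r_neq0.
have := is_derive_bigsum (index_enum V) predT
  (fun x => is_deriveM (is_derive_cst (c * eta x) (0 : R) (1 : R)) (D x)).
congr is_derive; rewrite mulrA mulr_sumr; apply: eq_bigr => x _.
rewrite /GRing.scale/= mulr0 addr0 mulr_sumr mulr_sumr; apply: eq_bigr => y _.
by rewrite gibbs_field_two_spin; ring.
Qed.

End spins.

(** * Diluted models on graphs of degree at most four *)

Lemma bernoulli_expect_double_sum (R : realType) (T V : finType) (q c : R)
    (A : {set T}) (g : {set T} -> V -> V -> R) :
  bernoulli_expect q A (fun S => c * \sum_x \sum_y g S x y) =
  c * \sum_x \sum_y bernoulli_expect q A (fun S => g S x y).
Proof.
rewrite bernoulli_expectE; under eq_bigr do rewrite mulrCA.
rewrite -mulr_sumr; congr (_ * _).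
under eq_bigr do rewrite mulr_sumr.
rewrite exchange_big; apply: eq_bigr => x _.
under eq_bigr do rewrite mulr_sumr.
by rewrite exchange_big.
Qed.

Section diluted_graph.
Variables (R : realType) (star : dilution) (V : finType) (adj : rel V).
Variables (p beta : R).
Hypotheses (adj_sym : symmetric adj) (adj_irr : irreflexive adj).
Hypothesis adj_deg : forall u, (#|[set v | adj u v]%SET| <= 4)%N.
Hypotheses (p01 : 0 < p <= 1) (beta_ge0 : 0 <= beta).
Implicit Types x y : V.

Local Notation two_spin x y := (fun z : V -> R[i] => complex.Re (z x * conjc (z y))).

Definition quenched_two_spin x y : R := quenched star adj p beta (two_spin x y).

Let p_01 : 0 <= p <= 1.
Proof. by case/andP: p01 => /ltW -> ->. Qed.

Definition bond_toggles (e : V * V) : {set {set V}} := [set [set e.1; e.2]]%SET.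
Definition site_toggles (e : V * V) : {set V} := [set e.1; e.2]%SET.

Lemma bond_weightE (omega : {set {set V}}) :
  xy_weight adj (fun u v => beta * ([set u; v]%SET \in omega)%:R) =
  scaled bond_toggles (adj_weight R adj) beta omega.
Proof.
apply/funext => e; rewrite /xy_weight /scaled /open_weight /adj_weight.
by rewrite /bond_toggles finset.sub1set; ring.
Qed.

Lemma site_weightE (eta : {set V}) :
  xy_weight adj (fun u v => beta * (u \in eta)%:R * (v \in eta)%:R) =
  scaled site_toggles (adj_weight R adj) beta eta.
Proof.
apply/funext => e; rewrite /xy_weight /scaled /open_weight /adj_weight.
by rewrite /site_toggles finset.subUset !finset.sub1set -mulnb natrM; ring.
Qed.

Lemma scaled_ge0 (T : finType) (tau : V * V -> {set T}) (S : {set T}) e :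
  0 <= scaled tau (adj_weight R adj) beta S e.
Proof. by rewrite mulr_ge0// open_weight_ge0// => ?; exact: adj_weight_ge0. Qed.

Lemma adj_weight_neq0 e : adj_weight R adj e != 0 -> adj e.1 e.2.
Proof. by rewrite /adj_weight; case: adj => //; rewrite mulr0 eqxx. Qed.

(** The two orientations of the edge weigh one half each. *)
Lemma bond_load i : i \in edges adj ->
  \sum_(e | i \in bond_toggles e) adj_weight R adj e <= 1.
Proof.
rewrite inE => /existsP[a /existsP[b /andP[ab /eqP ->]]].
have ab' : a != b by apply: contraTneq ab => ->; rewrite adj_irr.
apply: (@le_trans _ _ (\sum_(e in [set (a, b); (b, a)]%SET) (2^-1 : R))); last first.
  rewrite sumr_const cards2; case: (_ != _) => /=.
    by rewrite mulr2n; lra.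
  by rewrite mulr1n invf_le1// ler1n.
rewrite [leLHS]big_mkcond [leRHS]big_mkcond; apply: ler_sum => -[u v] _.
rewrite /bond_toggles !inE /= /adj_weight /=.
case: eqP => [e|_]; last by case: ifP.
have := finset.set21 u v; rewrite -e !inE => hu.
have := finset.set22 u v; rewrite -e !inE => hv.
have [uv|] := boolP (adj u v); last by rewrite mulr0; case: ifP.
have uv' : u != v by apply: contraTneq uv => ->; rewrite adj_irr.
rewrite mulr1 ifT//.
case/orP: hu => /eqP eu; case/orP: hv => /eqP ev; subst u v; rewrite ?eqxx ?orbT//.
  by rewrite eqxx in uv'.
by rewrite eqxx in uv'.
Qed.

(** The edges at i, in both orientations and with weight one half each, weigh the
    degree of i. *)
Lemma site_load i : \sum_(e | i \in site_toggles e) adj_weight R adj e <= 4.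
Proof.
have half u : \sum_v adj_weight R adj (u, v) <= 2.
  rewrite /adj_weight/= -mulr_sumr -natr_sum ler_pdivrMl// -natrM ler_nat.
  apply: leq_trans (adj_deg u) => //.
  by rewrite -sum1_card [X in (_ <= X)%N]big_mkcond/=; apply: leq_sum => v _; rewrite inE; case: adj.
rewrite (_ : 4 = 2 + 2 :> R); last by rewrite -natrD.
apply: (@le_trans _ _ (\sum_v adj_weight R adj (i, v) + \sum_u adj_weight R adj (i, u))); last by rewrite lerD.
rewrite [X in _ + X](eq_bigr (fun u => adj_weight R adj (u, i))); last first.
  by move=> u _; rewrite /adj_weight /= adj_sym.
rewrite big_mkcond -(pair_bigA _ (fun u v => if i \in site_toggles (u, v) then adj_weight R adj (u, v) else 0))/=.
apply: (@le_trans _ _ (\sum_u \sum_v ((u == i)%:R * adj_weight R adj (u, v) +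
   (v == i)%:R * adj_weight R adj (u, v)))).
  apply: ler_sum => u _; apply: ler_sum => v _; rewrite /site_toggles !inE /=.
  have := adj_weight_ge0 R adj (u, v).
  rewrite (eq_sym i u) (eq_sym i v); case: (u == i); case: (v == i);
    rewrite /= ?mul1r ?mul0r ?addr0 ?add0r => w0 //.
  by rewrite lerDl.
under [leLHS]eq_bigr => u _ do rewrite big_split/=.
rewrite big_split/= lerD//.
  rewrite (bigD1 i)//= [X in _ + X]big1 ?addr0 => [|u /negPf ui].
    by rewrite eqxx; under eq_bigr do rewrite mul1r.
  by rewrite big1// => v _; rewrite ui mul0r.
apply: ler_sum => u _; rewrite (bigD1 i)//= big1 ?addr0 ?eqxx ?mul1r// => v /negPf vi.
by rewrite vi mul0r.
Qed.

Lemma quenched_bondE x y : star = Bond -> quenched_two_spin x y =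
  bernoulli_expect p (edges adj) (fun S => corr (@dipole V)
    (scaled bond_toggles (adj_weight R adj) beta S) (unit_charge x - unit_charge y)).
Proof.
move=> starE; rewrite /quenched_two_spin /quenched /quenched_field starE.
rewrite !bernoulli_expectE; apply: eq_bigr => S _; congr (_ * _).
by rewrite gibbs_field_two_spin !mul1r bond_weightE.
Qed.

Lemma quenched_siteE x y : star = Site -> quenched_two_spin x y =
  bernoulli_expect p [set: V]%SET (fun S => (x \in S)%:R * (y \in S)%:R * corr (@dipole V)
    (scaled site_toggles (adj_weight R adj) beta S) (unit_charge x - unit_charge y)).
Proof.
move=> starE; rewrite /quenched_two_spin /quenched /quenched_field starE.
rewrite !bernoulli_expectE; apply: eq_bigr => S _; congr (_ * _).
by rewrite gibbs_field_two_spin site_weightE.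
Qed.

(** A vacant site is touched by no open edge, so its charge is conserved.  Hence the
    occupation factors of a two-spin mean may be dropped for distinct sites. *)
Lemma site_isolated (S : {set V}) x y : x != y -> x \notin S \/ y \notin S ->
  corr (@dipole V) (scaled site_toggles (adj_weight R adj) beta S)
    (unit_charge x - unit_charge y) = 0.
Proof.
move=> xy; rewrite /corr.
suff iso v : v \notin S -> (unit_charge x - unit_charge y) v != 0 ->
   fourier (@dipole V) (scaled site_toggles (adj_weight R adj) beta S)
     (unit_charge x - unit_charge y) = 0.
  case=> [xS|yS]; first rewrite (iso x) ?mul0r//; last rewrite (iso y) ?mul0r//.
    by rewrite !ffunE eqxx (negPf xy).
  by rewrite !ffunE eqxx (eq_sym y x) (negPf xy).
move=> vS sv; apply: (fourier_conserved (l := fun s => s v)) => //.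
  by rewrite ffunE.
move=> e s we.
have /andP[e1 e2] : (e.1 \in S) && (e.2 \in S).
  apply: contraNT we; rewrite /scaled /open_weight /site_toggles.
  by rewrite finset.subUset !finset.sub1set => /negPf ->; rewrite !mulr0.
have de : dipole e v = 0.
  have v1 : v != e.1 by apply: contraNneq vS => ->.
  have v2 : v != e.2 by apply: contraNneq vS => ->.
  by rewrite dipoleE (negPf v1) (negPf v2).
by rewrite (chargeDE s (dipole e)) (chargeDE s (- dipole e)) (chargeNE (dipole e)) de
    oppr0 addr0.
Qed.

Lemma quenched_two_spin_ge (b : R) x y : 0 <= b ->
  H_fun (dilution_kappa R star) b <=
    p ^+ dilution_alpha star * H_fun (dilution_kappa R star) beta ->
  x != y -> clean_two_point adj b x y <= quenched_two_spin x y.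
Proof.
move=> b_ge0 Hb xy; rewrite clean_two_pointE.
have w0 e : 0 <= adj_weight R adj e by exact: adj_weight_ge0.
case starE: star Hb => Hb.
  rewrite quenched_bondE//; apply: (dilution_comparison (alpha := 1) (kappa := 1)) => //.
    move=> e /adj_weight_neq0 ae; rewrite /bond_toggles cards1 finset.sub1set inE; split => //.
    by apply/existsP; exists e.1; apply/existsP; exists e.2; rewrite ae eqxx.
  exact: bond_load.
rewrite quenched_siteE// (_ : bernoulli_expect _ _ _ = bernoulli_expect p [set: V]%SET
   (fun S => corr (@dipole V) (scaled site_toggles (adj_weight R adj) beta S)
      (unit_charge x - unit_charge y))); last first.
  rewrite !bernoulli_expectE; apply: eq_bigr => S _; congr (_ * _).
  have [xS|xS] := boolP (x \in S); last by rewrite site_isolated ?mulr0//; left.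
  have [yS|yS] := boolP (y \in S); last by rewrite site_isolated ?mulr0//; right.
  by rewrite !mul1r.
apply: (dilution_comparison (alpha := 2) (kappa := 4)) => //.
  move=> e /adj_weight_neq0 ae; rewrite finset.subsetT; split => //.
  rewrite /site_toggles cards2; case: eqP ae => // ->.
  by rewrite adj_irr.
by move=> i _; exact: site_load.
Qed.

Lemma quenched_two_spin_diag x : quenched_two_spin x x = dilution_density star p.
Proof.
have c1 (T : finType) (tau : V * V -> {set T}) S :
    corr (@dipole V) (scaled tau (adj_weight R adj) beta S)
      (unit_charge x - unit_charge x) = 1.
  by rewrite subrr corr0// => e; exact: scaled_ge0.
case starE: star => /=.
  rewrite quenched_bondE// -[RHS](bernoulli_expect_cst p (edges adj)).
  by rewrite !bernoulli_expectE; apply: eq_bigr => S _; rewrite c1.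
rewrite quenched_siteE// (bernoulli_expect_split p _ (finset.in_setT x)).
rewrite -[RHS](bernoulli_expect_cst p ([set: V] :\ x)%SET).
rewrite !bernoulli_expectE; apply: eq_bigr => S.
rewrite powersetE finset.subsetD1 => /andP[_ xS]; congr (_ * _).
by rewrite !c1 (negPf xS) finset.setU11 !(mulr1, mulr0) addr0.
Qed.

Lemma quenched_two_spin_ge0 x y : 0 <= quenched_two_spin x y.
Proof.
have c0 (T : finType) (tau : V * V -> {set T}) S :
    0 <= corr (@dipole V) (scaled tau (adj_weight R adj) beta S)
      (unit_charge x - unit_charge y).
  by apply: corr_ge0 => e; exact: scaled_ge0.
case starE: star.
  rewrite quenched_bondE// -[leLHS](bernoulli_expect_cst p (edges adj)).
  by apply: bernoulli_expect_le => // S _; exact: c0.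
rewrite quenched_siteE// -[leLHS](bernoulli_expect_cst p [set: V]%SET).
by apply: bernoulli_expect_le => // S _; apply: mulr_ge0; [rewrite mulr_ge0 | exact: c0].
Qed.

Lemma quenched_double_sum (c : R) :
  quenched star adj p beta (fun z => c * \sum_x \sum_y complex.Re (z x * conjc (z y))) =
  c * \sum_x \sum_y quenched_two_spin x y.
Proof.
rewrite /quenched_two_spin /quenched /quenched_field; case: star.
  by rewrite -bernoulli_expect_double_sum !bernoulli_expectE; apply: eq_bigr => S _;
    rewrite gibbs_field_double_sum.
by rewrite -bernoulli_expect_double_sum !bernoulli_expectE; apply: eq_bigr => S _;
    rewrite gibbs_field_double_sum.
Qed.

Lemma structure_factorE : structure_factor star adj p beta =
  #|V|%:R^-1 * \sum_x \sum_y quenched_two_spin x y.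
Proof.
rewrite -[\sum_x \sum_y _]mul1r -quenched_double_sum /structure_factor.
have -> // : (fun z : V -> R[i] => sqr_modulus (\sum_x z x)) =
  (fun z => 1 * \sum_x \sum_y complex.Re (z x * conjc (z y))).
by apply/funext => z; rewrite mul1r sqr_modulus_sum.
Qed.

Lemma magnetizationE : quenched star adj p beta (fun z => sqr_modulus (magnetization z)) =
  #|V|%:R^-1 * structure_factor star adj p beta.
Proof.
rewrite structure_factorE mulrA -quenched_double_sum.
have -> // : (fun z : V -> R[i] => sqr_modulus (magnetization z)) =
  (fun z => #|V|%:R^-1 * #|V|%:R^-1 * \sum_x \sum_y complex.Re (z x * conjc (z y))).
apply/funext => z; rewrite -sqr_modulus_sum /magnetization !sqr_modulusE.
have -> : (#|V|%:R^-1 : R[i]) = (#|V|%:R^-1)%:C%C by rewrite fmorphV rmorph_nat.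
by case: (\sum_x z x) => a b /=; ring.
Qed.

Lemma susceptibilityE : susceptibility star adj p beta =
  beta / 2 * structure_factor star adj p beta.
Proof.
have D (T : finType) (tau : V * V -> {set T}) (eta : {set T} -> V -> R)
    (J : {set T} -> V -> V -> R) (A : {set T}) :
  (forall S, xy_weight adj (J S) = scaled tau (adj_weight R adj) beta S) ->
  derive1 (fun h => bernoulli_expect p A (fun S => gibbs_field adj beta (J S) (eta S) h
    (fun z => #|V|%:R^-1 * \sum_x complex.Re (z x)))) 0 =
  bernoulli_expect p A (fun S => beta / 2 * (#|V|%:R^-1 *
    \sum_x \sum_y gibbs_field adj beta (J S) (eta S) 0 (two_spin x y))).
  move=> JE; rewrite derive1E.
  have DS S : is_derive (0 : R) (1 : R) (fun h => bernoulli_weight p A S *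
      gibbs_field adj beta (J S) (eta S) h (fun z => #|V|%:R^-1 * \sum_x complex.Re (z x)))
    (bernoulli_weight p A S * (beta / 2 * (#|V|%:R^-1 *
    \sum_x \sum_y gibbs_field adj beta (J S) (eta S) 0 (two_spin x y)))).
    have w0 e : 0 <= xy_weight adj (J S) e by rewrite JE scaled_ge0.
    have dS := is_derive_gibbs_field beta (eta S) (#|V|%:R^-1) w0.
    have := is_deriveM (is_derive_cst (bernoulli_weight p A S) (0 : R) (1 : R)) dS.
    by rewrite /GRing.scale/= mulr0 addr0.
  by have [_ dE] := is_derive_bigsum (index_enum {set T}) (fun S => S \in powerset A) DS.
rewrite structure_factorE mulrA -quenched_double_sum /susceptibility /quenched /quenched_field.
case: star.
  rewrite (D _ bond_toggles (fun _ _ => 1)); last exact: bond_weightE.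
  rewrite !bernoulli_expectE; apply: eq_bigr => S _; congr (_ * _).
  by rewrite gibbs_field_double_sum mulrA.
rewrite (D _ site_toggles (fun S x => (x \in S)%:R)); last exact: site_weightE.
rewrite !bernoulli_expectE; apply: eq_bigr => S _; congr (_ * _).
by rewrite gibbs_field_double_sum mulrA.
Qed.

Lemma quenchedC_two_spin x y :
  quenchedC star adj p beta (fun z => z x * conjc (z y)) = (quenched_two_spin x y)%:C%C.
Proof.
rewrite /quenchedC -/(quenched_two_spin x y); congr (_ +i* _)%C.
rewrite /quenched /quenched_field; case: star.
  rewrite -[RHS](bernoulli_expect_cst p (edges adj)) !bernoulli_expectE.
  by apply: eq_bigr => S _; rewrite gibbs_field_Im.
rewrite -[RHS](bernoulli_expect_cst p [set: V]%SET) !bernoulli_expectE.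
by apply: eq_bigr => S _; rewrite gibbs_field_Im.
Qed.

(** Shells contribute r by [box_sum_ge]; the site itself contributes the density. *)
Lemma quenched_row_ge (r : nat) (b : R) (phi : box r -> V) : 0 <= b ->
  (forall k, (0 < k)%N -> 1 <= shell_sum k b) ->
  H_fun (dilution_kappa R star) b <=
    p ^+ dilution_alpha star * H_fun (dilution_kappa R star) beta ->
  injective phi -> (forall y y' : box r, box_adj y y' -> adj (phi y) (phi y')) ->
  r%:R + dilution_density star p <= \sum_y quenched_two_spin (phi (box_origin r)) y.
Proof.
move=> b_ge0 shell1 Hb phi_inj hom.
rewrite -(quenched_two_spin_diag (phi (box_origin r))).
apply: (box_sum_ge b_ge0 shell1 phi_inj hom) => [v|v vo].
  exact: quenched_two_spin_ge0.
by apply: quenched_two_spin_ge => //; rewrite eq_sym.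
Qed.

End diluted_graph.

(** * Boxes and tori *)

Section box_graph.
Variable r : nat.
Implicit Types u v : box r.

Lemma box_adj_sym : symmetric (@box_adj r).
Proof. by move=> u v; rewrite /box_adj distrC [X in _ + X]distrC. Qed.

Lemma box_adj_irr : irreflexive (@box_adj r).
Proof. by move=> u; rewrite /box_adj !subrr. Qed.

Lemma box_adj_deg u : (#|[set v | box_adj u v]%SET| <= 4)%N.
Proof.
pose s := [:: box_vertex r (box_pos u + (1, 0)); box_vertex r (box_pos u + (-1, 0));
  box_vertex r (box_pos u + (0, 1)); box_vertex r (box_pos u + (0, -1))].
apply: leq_trans (card_size s); apply: subset_leq_card; apply/fintype.subsetP => v.
rewrite inE box_adjE => uv.
have : box_pos v \in [:: box_pos u + (1, 0); box_pos u + (-1, 0);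
    box_pos u + (0, 1); box_pos u + (0, -1)].
  move: uv; case: (box_pos u) => a b; case: (box_pos v) => c d /=.
  rewrite !inE !xpair_eqE /=; lia.
by move=> /(map_f (box_vertex r)); rewrite box_posK.
Qed.

End box_graph.

Section torus_graph.
Variable L : nat.
Hypothesis L3 : (3 <= L)%N.

Lemma ordS_neq (i : 'I_L) : ordS i != i.
Proof.
apply/eqP => /(congr1 (@nat_of_ord L)) /= e; have iL := ltn_ord i.
have [lt|ge] := ltnP i.+1 L.
  by move: e; rewrite modn_small// => e; lia.
have eL : i.+1 = L by lia.
by move: e; rewrite eL modnn => e; lia.
Qed.

Lemma torus_adj_sym : symmetric (@torus_adj L).
Proof.
move=> u v; rewrite /torus_adj /cycle_adj (eq_sym u.1 v.1) (eq_sym u.2 v.2).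
by rewrite (orbC (v.2 == _)) (orbC (v.1 == ordS _)).
Qed.

Lemma torus_adj_irr : irreflexive (@torus_adj L).
Proof.
by move=> u; rewrite /torus_adj /cycle_adj !eqxx !orbb /= !(eq_sym _ (ordS _))
  !(negPf (ordS_neq _)).
Qed.

Lemma torus_adj_deg (u : torus L) : (#|[set v | torus_adj u v]%SET| <= 4)%N.
Proof.
pose s : seq (torus L) := [:: (u.1, ordS u.2); (u.1, ord_pred u.2);
  (ordS u.1, u.2); (ord_pred u.1, u.2)].
apply: leq_trans (card_size s); apply: subset_leq_card; apply/fintype.subsetP => -[a b].
rewrite inE /torus_adj /cycle_adj /s !inE !xpair_eqE /=.
case/orP => /andP[/eqP <- /orP[/eqP ->|/eqP ->]]; rewrite ?ordSK !eqxx ?orbT//.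
Qed.

Variable r : nat.
Hypothesis rL : (r.*2.+1 <= L)%N.

Let L_gt0 : (0 < L)%N := ltn_trans (isT : 0 < 2)%N L3.

(** Offsets run over 0, ..., 2 r with centre r, hence the shift by L - r. *)
Definition wrap (i : 'I_L) (a : nat) : 'I_L :=
  Ordinal (ltn_pmod (i + (a + (L - r))) L_gt0).

Lemma wrap_center i : wrap i r = i.
Proof.
apply/val_inj => /=; rewrite subnKC; last lia.
by rewrite modnDr modn_small.
Qed.

Lemma wrapS i a : wrap i a.+1 = ordS (wrap i a).
Proof. by apply/val_inj; rewrite /= -[in RHS]addn1 modnDml addn1 addSn addnS. Qed.

Lemma wrap_inj i (a b : 'I_(r.*2.+1)) : wrap i a = wrap i b -> a = b.
Proof.
move=> /(congr1 val) /= /eqP; rewrite eqn_modDl eqn_modDr.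
by rewrite !modn_small ?(leq_trans (ltn_ord _))// => /eqP/val_inj.
Qed.

Definition torus_chart (x : torus L) (y : box r) : torus L :=
  (wrap x.1 y.1, wrap x.2 y.2).

Lemma torus_chart_origin x : torus_chart x (box_origin r) = x.
Proof.
case: x => a b; rewrite /torus_chart /box_origin /box_vertex /=.
by rewrite !inordK ?wrap_center//; lia.
Qed.

Lemma torus_chart_inj x : injective (torus_chart x).
Proof.
move=> [a b] [c d] e; congr pair; apply: wrap_inj.
  exact: (congr1 fst e).
exact: (congr1 snd e).
Qed.

Lemma torus_chart_adj x (y y' : box r) : box_adj y y' ->
  torus_adj (torus_chart x y) (torus_chart x y').
Proof.
move: y y' => [a b] [c d]; rewrite /box_adj /box_pos /torus_adj /torus_chart /cycle_adj /= => H.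
have [[ac [bd|bd]]|[bd [ac|ac]]] : ((a = c :> nat) /\ ((d = b.+1 :> nat) \/ (b = d.+1 :> nat)))
  \/ ((b = d :> nat) /\ ((c = a.+1 :> nat) \/ (a = c.+1 :> nat))) by lia.
- by rewrite ac bd wrapS !eqxx.
- by rewrite ac bd wrapS !eqxx orbT.
- by rewrite bd ac wrapS !eqxx orbT.
- by rewrite bd ac wrapS !eqxx !orbT.
Qed.

End torus_graph.

Lemma card_box r : #|{: box r}| = ((2 * r + 1) ^ 2)%N.
Proof. by rewrite card_prod card_ord addn1 mul2n expnS expn1. Qed.

Theorem proposition5p1 (R : realType) (star : dilution) (p beta b0 : R)
  (hp : 0 < p <= 1) (hbeta : 0 <= beta)
  (hb0 : beta_BKT R = b0%:E)
  (hcond : p ^+ dilution_alpha star * H_fun (dilution_kappa R star) beta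
           >= H_fun (dilution_kappa R star) b0) :
  let d := dilution_density star p in
  (forall r : nat, (1 <= r)%N ->
    let m := r./2 in
    let N := ((2 * r + 1) ^ 2)%N in
    let Ncore := ((2 * m + 1) ^ 2)%N in
    \sum_(y : box r)
        quenchedC star (@box_adj r) p beta
          (fun z => z (box_origin r) * conjc (z y))
      >= (r%:R + d)%:C%C
    /\ structure_factor star (@box_adj r) p beta
      >= d + Ncore%:R / N%:R * m%:R)
  /\
  (forall L : nat, (3 <= L)%N ->
    let r := (L.-1)./2 in
    [/\ structure_factor star (@torus_adj L) p beta >= r%:R + d,
        quenched star (@torus_adj L) p beta
          (fun z => sqr_modulus (magnetization z)) >= (r%:R + d) / L%:R ^+ 2
      & susceptibility star (@torus_adj L) p beta >= beta / 2 * (r%:R + d)]).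
Proof.
move=> d; have b0_ge0 := critical_ge0 hb0.
have shell1 k : (0 < k)%N -> 1 <= shell_sum k b0 by exact: critical_shell_ge1.
have row (V : finType) (adj : rel V) (r : nat) (phi : box r -> V) :
    symmetric adj -> irreflexive adj -> (forall u, (#|[set v | adj u v]%SET| <= 4)%N) ->
    injective phi -> (forall y y' : box r, box_adj y y' -> adj (phi y) (phi y')) ->
    r%:R + d <= \sum_y quenched_two_spin star adj p beta (phi (box_origin r)) y.
  move=> asym airr adeg.
  exact: (quenched_row_ge asym airr adeg hp hbeta b0_ge0 shell1 hcond).
split=> [r r1 m N Ncore|L L3 r].
  have [bsym [birr bdeg]] := conj (@box_adj_sym r) (conj (@box_adj_irr r) (@box_adj_deg r)).
  split.
    under eq_bigr do rewrite quenchedC_two_spin.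
    rewrite -rmorph_sum lecR.
    by apply: (row _ _ r id) => //; exact: inj_id.
  have N0 : 0 < N%:R :> R by rewrite ltr0n expn_gt0 addn1.
  rewrite structure_factorE card_box -/N ler_pdivlMl//.
  have -> : N%:R * (d + Ncore%:R / N%:R * m%:R) = N%:R * d + Ncore%:R * m%:R.
    by field; rewrite gt_eqF.
  (* What a row sum exceeds the diagonal term by: it is nonnegative for every x, and
     at least m for x in the core. *)
  pose excess (x : box r) := \sum_y quenched_two_spin star (@box_adj r) p beta x y - d.
  have excess0 x : 0 <= excess x.
    rewrite subr_ge0 (bigD1 x)//= quenched_two_spin_diag// lerDl.
    by apply: sumr_ge0 => y _; exact: quenched_two_spin_ge0.
  have -> : \sum_x \sum_y quenched_two_spin star (@box_adj r) p beta x y =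
      N%:R * d + \sum_x excess x.
    rewrite sumrB sumr_const card_box -/N mulr_natl addrC subrK//.
  rewrite lerD2l.
  have mr : (m + m <= r)%N by rewrite addnn -[leqRHS]odd_double_half leq_addl.
  have cr : (sup_norm 0%R + m <= r)%N.
    by rewrite [sup_norm 0](_ : _ = 0%N)// add0n (leq_trans _ mr)// leq_addr.
  apply: (@le_trans _ _ (\sum_(y : box m) excess (box_shift r 0 y))); last first.
    apply: (@sum_inj_le _ _ _ (@box_shift m r 0) predT predT excess) => //.
    exact: box_shift_inj.
  have -> : Ncore = #|{: box m}| by rewrite card_box.
  rewrite mulr_natl -sumr_const.
  apply: ler_sum => y _; rewrite /excess lerBrDr.
  have cy : (sup_norm (box_pos (box_shift r 0%R y)) + m <= r)%N.
    rewrite box_pos_shift// add0r (leq_trans _ mr)// leq_add2r.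
    exact: box_pos_norm.
  have := row _ (@box_adj r) m (@box_shift m r (box_pos (box_shift r 0 y)))
    bsym birr bdeg (box_shift_inj cy).
  rewrite box_shift_center; apply => u v uv.
  by rewrite box_shift_adj.
have rL : (r.*2.+1 <= L)%N.
  by rewrite /r; have := odd_double_half L.-1; lia.
have S1 : r%:R + d <= structure_factor star (@torus_adj L) p beta.
  rewrite structure_factorE ler_pdivlMl; last first.
    by rewrite ltr0n card_prod card_ord muln_gt0 (ltn_trans _ L3).
  rewrite mulr_natl -sumr_const; apply: ler_sum => x _.
  have := row _ (@torus_adj L) r (@torus_chart L L3 r x) (@torus_adj_sym L)
    (torus_adj_irr L3) (@torus_adj_deg L) (@torus_chart_inj L L3 r rL x)
    (@torus_chart_adj L L3 r rL x).
  by rewrite torus_chart_origin.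
split=> //.
  rewrite magnetizationE card_prod card_ord natrM -expr2 mulrC.
  by rewrite ler_wpM2l ?invr_ge0 ?exprn_ge0.
by rewrite susceptibilityE// ler_wpM2l// divr_ge0.
Qed.
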